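(* Consider a sequence of weighted graphs $G_n=(V_n,E_n,(c_{xy})_{xy\in E_n})$ with $|V_n|=n$ and site-weights $\pi=\pi_n$ which is finite-dimensional (Assumption A below) and uniformly elliptic (Assumption B below). Let $k=k_n$ be a sequence such that $k\to\infty$ and, for some $c_{\rm vol}\in[0,\infty)$, $\limsup_{n\to\infty}k/n^2\le c_{\rm vol}$. Then for all $\delta\in(0,1)$ there exists $C=C(\delta)>0$ such that, for all $p\in[1,2]$, $$\limsup_{n\to\infty}\sqrt k\,\sup_{\eta\in\Delta}\mathbb E^{\rm Avg}_\eta\Big[\Big\|\frac{\eta_{t^+}}{\pi}-1\Big\|_p\Big]\le\delta,\qquad \liminf_{n\to\infty}\sqrt k\,\sup_{\eta\in\Delta}\mathbb E^{\rm Avg}_\eta\Big[\Big\|\frac{\eta_{t^-}}{\pi}-1\Big\|_p\Big]\ge\frac1\delta,$$ where $t^\pm=t^\pm(C)=\frac{t_{\rm rel}}2\log k\pm C\,t_{\rm rel}$ and $(\eta_t)_{t\ge0}$ is the Averaging process.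
   Context: Graphs are finite, connected, undirected, with positive symmetric edge weights $c_{xy}>0$; $\pi=(\pi(x))_{x\in V}$ is a probability measure on $V$ with $\pi(x)>0$ for all $x$. Everything depends on $n$; the dependence is dropped from the notation. $\|\psi\|_p^p=\sum_{x}\pi(x)|\psi(x)|^p$. $\Delta$ is the set of probability measures on $V$. The Averaging process $(\eta_t)_{t\ge0}$ is the Markov process on $\Delta$ with generator $\mathcal L^{\rm Avg}f(\eta)=\sum_{xy\in E}c_{xy}\big(f(\eta^{xy})-f(\eta)\big)$, where $\eta^{xy}(x)=\frac{\pi(x)}{\pi(x)+\pi(y)}(\eta(x)+\eta(y))$, $\eta^{xy}(y)=\frac{\pi(y)}{\pi(x)+\pi(y)}(\eta(x)+\eta(y))$, $\eta^{xy}(z)=\eta(z)$ for $z\neq x,y$. $\mathbb E^{\rm Avg}_\eta$ is expectation when $\eta_0=\eta$. The one-particle process $\mathrm{Bin}(1)$ is the Markov chain on $V$ with generator $L^{\mathrm{Bin}(1)}\psi(x)=\sum_{y:xy\in E}c_{xy}\frac{\pi(y)}{\pi(x)+\pi(y)}(\psi(y)-\psi(x))$, reversible w.r.t. $\pi$, with Dirichlet form $\mathcal E_{\mathrm{Bin}(1)}(\psi)=\sum_{xy\in E}c_{xy}\frac{\pi(x)\pi(y)}{\pi(x)+\pi(y)}(\psi(x)-\psi(y))^2$; $\mathrm{gap}$ is the smallest positive eigenvalue of $-L^{\mathrm{Bin}(1)}$ and $t_{\rm rel}=\mathrm{gap}^{-1}$. Assumption A (finite-dimensional geometries): for every $n$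 there are positive constants $d=d(n)$, $t_{\rm Nash}=t_{\rm Nash}(n)$, $T=T(n)$ such that the Nash inequality $$\|\psi\|_2^{2(1+2/d)}\le t_{\rm Nash}\big(\mathcal E_{\mathrm{Bin}(1)}(\psi)+T^{-1}\|\psi\|_2^2\big)\|\psi\|_1^{4/d},\qquad \psi:V\to\mathbb R,$$ holds, and $d=O(1)$, $t_{\rm Nash}=O(t_{\rm rel})$, $T=\Theta(t_{\rm Nash})$ as $n\to\infty$. Assumption B (uniform ellipticity): for some $c_{\rm ell}\in[1,\infty)$, $\sup_n\frac{\max_{x\in V}\pi(x)}{\min_{y\in V}\pi(y)}\le c_{\rm ell}$. *)

(* Defs.v *)
From HB Require Import structures.
From mathcomp Require Import all_boot all_order all_algebra.
From mathcomp Require Import all_classical all_reals all_analysis.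
Import Order.TTheory GRing.Theory Num.Theory.
Import numFieldNormedType.Exports.

Set Implicit Arguments.
Unset Strict Implicit.
Unset Printing Implicit Defensive.

Local Open Scope classical_set_scope.
Local Open Scope ring_scope.

(* Edge weights are only meaningful on edges: [weight x y] is ignored when
   [edge x y] is false. *)
Record wgraph (R : realType) := WGraph {
  vertex :> finType;
  edge : rel vertex;
  weight : vertex -> vertex -> R;
  site : vertex -> R;
  edge_sym : symmetric edge;
  edge_irr : irreflexive edge;
  edge_connected : forall x y, connect edge x y;
  weight_sym : forall x y, weight x y = weight y x;
  weight_gt0 : forall x y, edge x y -> 0 < weight x y;
  site_gt0 : forall x, 0 < site x;
  site_sum : \sum_x site x = 1
}.

Section Graph.
Variables (R : realType) (G : wgraph R).
Implicit Types (x y z : G) (psi : G -> R).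

(* Sum over unordered edges of a function that is symmetric in its two
   arguments: each edge is met twice in the ordered sum. *)
Definition sum_edges (F : G -> G -> R) : R :=
  2^-1 * \sum_x \sum_(y | edge x y) F x y.

Definition pnorm (p : R) psi : R :=
  (\sum_x site x * `|psi x| `^ p) `^ p^-1.

Definition bin1_gen psi : G -> R := fun x =>
  \sum_(y | edge x y)
     weight x y * (site y / (site x + site y)) * (psi y - psi x).

Definition bin1_dirichlet psi : R :=
  sum_edges (fun x y =>
    weight x y * (site x * site y / (site x + site y)) * (psi x - psi y) ^+ 2).

Definition bin1_eigenvalue (lam : R) : Prop :=
  exists2 psi : G -> R,
    (exists x, psi x != 0) & forall x, - bin1_gen psi x = lam * psi x.

(* The spectrum is finite and, with at least two vertices, it has a positive
   element, so that this infimum is a minimum. *)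
Definition gap : R := inf [set lam : R | 0 < lam /\ bin1_eigenvalue lam].

Definition trel : R := gap^-1.

Definition nash (d tN T : R) : Prop := forall psi : G -> R,
  pnorm 2 psi `^ (2 * (1 + 2 / d)) <=
  tN * (bin1_dirichlet psi + T^-1 * pnorm 2 psi ^+ 2) * pnorm 1 psi `^ (4 / d).

Record simplex := Simplex {
  mass :> G -> R;
  mass_ge0 : forall x, 0 <= mass x;
  mass_sum : \sum_x mass x = 1
}.

HB.instance Definition _ := gen_eqMixin simplex.
HB.instance Definition _ := gen_choiceMixin simplex.
HB.instance Definition _ := isPointed.Build simplex
  (Simplex (fun x => ltW (site_gt0 x)) (site_sum G)).

Definition coord_events : set (set simplex) :=
  [set A | exists x (B : set R),
     measurable B /\ A = [set eta : simplex | B (eta x)]].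

HB.instance Definition _ := Measurable.copy simplex
  (g_sigma_algebraType coord_events).

Definition avg_mass x y (eta : G -> R) : G -> R := fun z =>
  if z == x then site x / (site x + site y) * (eta x + eta y)
  else if z == y then site y / (site x + site y) * (eta x + eta y)
  else eta z.

Lemma avg_mass_ge0 x y (eta : simplex) z : 0 <= avg_mass x y eta z.
Proof.
rewrite /avg_mass; have h u v : 0 <= site u / (site x + site y) * (eta v + eta y).
  by rewrite mulr_ge0 ?divr_ge0 ?addr_ge0 ?mass_ge0 // ltW ?site_gt0.
by case: ifP => // _; case: ifP => // _; exact: mass_ge0.
Qed.

Lemma avg_mass_sum x y (eta : simplex) : \sum_z avg_mass x y eta z = 1.
Proof.
have s0 : site x + site y != 0 by rewrite gt_eqF // addr_gt0 ?site_gt0.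
have [exy|nxy] := eqVneq x y.
  subst y; rewrite -(mass_sum eta); apply: eq_bigr => z _; rewrite /avg_mass.
  case: eqP => // ->; apply: (mulfI s0).
  by rewrite mulrA mulrCA divff // mulr1 mulrDr mulrDl.
rewrite -(mass_sum eta) (bigD1 x) //= (bigD1 y) 1?eq_sym //=.
rewrite [RHS](bigD1 x) //= [X in _ = _ + X](bigD1 y) 1?eq_sym //=.
rewrite /avg_mass eqxx eq_sym (negbTE nxy) eqxx !addrA; congr (_ + _).
  by rewrite -mulrDl -mulrDl divff // mul1r.
by apply: eq_bigr => z /andP[/negbTE -> /negbTE ->].
Qed.

Definition avg_update x y (eta : simplex) : simplex :=
  Simplex (avg_mass_ge0 x y eta) (avg_mass_sum x y eta).

Definition avg_gen (f : simplex -> R) : simplex -> R := fun eta =>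
  sum_edges (fun x y => weight x y * (f (avg_update x y eta) - f eta)).

(* [avg_gen] is a bounded operator on bounded functions, so the Markov
   semigroup that it generates is its exponential series, which converges at
   every bounded [f]. *)
Definition avg_semigroup (t : R) (f : simplex -> R) : simplex -> R := fun eta =>
  limn (series (fun m => t ^+ m / m`!%:R * iter m avg_gen f eta)).

(* A Markov process started from [eta0] with generator [avg_gen]. Times are
   nonnegative reals: the values of [avg_state] at negative times are
   unconstrained. [avg_markov] says that, for bounded measurable f,
   E[f(eta_t) | F_s] = (avg_semigroup (t - s) f)(eta_s), where F_s is the
   natural filtration. *)
Record averaging_process (eta0 : simplex) := AveragingProcess {
  avg_disp : measure_display;
  avg_space : measurableType avg_disp;
  avg_prob : probability avg_space R;
  avg_state : R -> avg_space -> simplex;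
  avg_measurable : forall t, measurable_fun [set: avg_space] (avg_state t);
  avg_initial : avg_prob [set w | avg_state 0 w = eta0] = 1%E;
  avg_markov : forall (s t : R) (f : simplex -> R) (A : set avg_space),
    0 <= s -> s <= t ->
    measurable_fun [set: simplex] f ->
    (exists M : R, forall eta, `|f eta| <= M) ->
    (<<s \bigcup_(u in [set u : R | 0 <= u /\ u <= s])
           g_sigma_algebra_preimage (avg_state u) >>) A ->
    (\int[avg_prob]_(w in A) (f (avg_state t w))%:E =
     \int[avg_prob]_(w in A) (avg_semigroup (t - s) f (avg_state s w))%:E)%E
}.

Arguments avg_state {eta0} _ _ _.

Definition rel_density (eta : simplex) : G -> R := fun x => eta x / site x.

(* [P] gives a version of the process from every starting point. *)
Definition worst_distance (P : forall eta, averaging_process eta)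
    (p t : R) : \bar R :=
  ereal_sup [set ('E_(avg_prob (P eta))[fun w =>
      pnorm p (fun x => rel_density (avg_state (P eta) t w) x - 1)%R])%E
    | eta in [set: simplex]].

End Graph.

Arguments avg_state {R G eta0} _ _ _.

(* For both assumptions, sequences of graphs are indexed by their number of
   vertices and start at n = 2, since the gap needs two vertices. *)
Definition finite_dimensional (R : realType) (G : nat -> wgraph R) : Prop :=
  exists d tN T : nat -> R,
    [/\ forall n, (2 <= n)%N ->
          [/\ 0 < d n, 0 < tN n, 0 < T n & nash (G n) (d n) (tN n) (T n)],
        d =O_\oo (fun _ => 1 : R),
        tN =O_\oo (fun n => trel (G n)) &
        T =Theta_\oo tN].

Definition max_site (R : realType) (G : wgraph R) : R :=
  \big[Num.max/0]_(x : G) site x.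

(* The default value 1 is harmless: every site weight is at most 1. *)
Definition min_site (R : realType) (G : wgraph R) : R :=
  \big[Num.min/1]_(x : G) site x.

Definition uniformly_elliptic (R : realType) (G : nat -> wgraph R) : Prop :=
  exists2 c : R, 1 <= c &
    forall n, (2 <= n)%N -> max_site (G n) / min_site (G n) <= c.

(* Main.v *)
Require Import Defs.
From HB Require Import structures.
From mathcomp Require Import all_boot all_order all_algebra.
From mathcomp Require Import all_classical all_reals all_analysis.
From mathcomp Require Import measurable_realfun.
From mathcomp Require Import ring lra.
Import Order.TTheory GRing.Theory Num.Theory.
Import numFieldNormedType.Exports.

Set Implicit Arguments.
Unset Strict Implicit.
Unset Printing Implicit Defensive.
Local Open Scope classical_set_scope.
Local Open Scope ring_scope.

(** Write [rho] for the density [eta / site], [X = ||rho||_2^2] ([sq_density]),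
    [E] for the Dirichlet form of the one-particle chain and [L] for [avg_gen].

    Lower bound.  Let [f] be an eigenfunction for the gap, scaled so that
    [|f| <= 1] and [f x0 = 1].  Started from the point mass at [x0], the pairing
    of [eta_t] with [f] has mean exactly [exp (- gap t)], because [L] acts on
    linear functions of [eta] as the one-particle generator.  This pairing is at
    most [||rho - 1||_1], hence at most every [||rho - 1||_p], and at time [t-]
    the mean equals [exp C / sqrt k] ([worst_distance_ge]).

    Upper bound.  By Jensen's inequality it suffices that the mean of [X - 1] is
    of order [exp (- 2 gap t)] at time [t+].  Averaging an edge removes from [X]
    exactly the energy of that edge, so [L X = - E(rho)]
    ([avg_gen_sq_density]).  The Poincare inequality then yields only the rate
    [gap], half of what is needed: the randomness of the updates compensates
    half of the dissipation of the heat flow.  The sharp rate comes from the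
    fact that this noise is spread over all modes, while the slow decay concerns
    only the low ones.

    - The Nash inequality turns [L X = - E(rho)] into a superlinear differential
      inequality for the mean of [X], which is therefore bounded by a constant
      after a time [T = O(trel)], whatever the initial measure
      ([nash_smoothing]).

    - Each mode of eigenvalue [lam] is damped at the rate [lam] in mean, so over
      the time [T] the modes with [lam < 4 gap] lose a bounded factor only.  Their
      total energy [g] is thus bounded at time 0, uniformly over the initial
      measures, point masses included ([low_energy_bound]).

    - One update along [xy] displaces a mass proportional to
      [conduct x y = O(1/n)], and the low modes are bounded, so
      [L g <= - 2 gap g + eps E(rho)] with [eps = O(1/n)]
      ([avg_gen_low_energy]).  The high modes give [E(rho) >= 4 gap (X - 1 - g)]
      ([high_modes_dissipation]).  Together, [V = g + 2 eps (X - 1)] satisfies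
      [L V <= - 2 gap (1 - 2 eps) V], and [V] is bounded at time 0 since
      [X = O(n)].

    - After time [T], [X - 1] decays at rate [4 gap] up to a forcing of order
      [V], so it inherits the decay of [V] ([variance_decay]).  As
      [log k = O(log n)], the correction [eps] changes the result at time [t+] by
      a bounded factor.

    Expectations are handled through [avg_semigroup]: its power series is
    differentiated term by term ([is_derive_semigroup]), and its positivity on
    bounded measurable functions comes from the Markov property at time 0
    ([semigroup_expectation]). *)

(** * Spectral theorem for real symmetric matrices *)

Section dot.
Variables (R : realType) (n : nat).
Implicit Types u v w : 'rV[R]_n.

Definition dot u v : R := \sum_j u 0 j * v 0 j.

Lemma dotE u v : dot u v = (u *m v^T) 0 0.
Proof. by rewrite mxE; apply: eq_bigr => j _; rewrite mxE. Qed.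

Lemma dotC u v : dot u v = dot v u.
Proof. by apply: eq_bigr => j _; rewrite mulrC. Qed.

Lemma dotDl u v w : dot (u + v) w = dot u w + dot v w.
Proof. by rewrite -big_split; apply: eq_bigr => j _; rewrite mxE mulrDl. Qed.

Lemma dotZl (a : R) u v : dot (a *: u) v = a * dot u v.
Proof. by rewrite mulr_sumr; apply: eq_bigr => j _; rewrite mxE mulrA. Qed.

Lemma dotDr u v w : dot w (u + v) = dot w u + dot w v.
Proof. by rewrite dotC dotDl !(dotC w). Qed.

Lemma dotZr (a : R) u v : dot v (a *: u) = a * dot v u.
Proof. by rewrite dotC dotZl dotC. Qed.

Lemma dot_sqr_ge0 u : 0 <= dot u u.
Proof. by apply: sumr_ge0 => j _; rewrite -expr2 sqr_ge0. Qed.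

Lemma dot_eq0 u : (dot u u == 0) = (u == 0).
Proof.
apply/idP/eqP => [|->]; last by rewrite /dot big1 // => j _; rewrite mxE mul0r.
rewrite psumr_eq0 => [/allP h|j _]; last by rewrite -expr2 sqr_ge0.
apply/rowP => j; rewrite mxE; apply/eqP.
by have := h j (mem_index_enum j); rewrite /= mulf_eq0 orbb.
Qed.

Lemma dot_mulmx (S : 'M[R]_n) u v : S^T = S -> dot (u *m S) v = dot u (v *m S).
Proof. by move=> symS; rewrite !dotE trmx_mul symS mulmxA. Qed.

Lemma mulmx_coord_continuous p (M : 'M[R]_(n, p)) j :
  continuous (fun u : 'rV[R]_n => (u *m M) 0 j).
Proof.
under eq_fun do rewrite mxE.
apply: continuous_big => [|i _]; first exact: add_continuous.
move=> u; apply: continuousM; last exact: cst_continuous.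
exact: (@coord_continuous R 1 n 0 i).
Qed.

Lemma quadratic_form_continuous (M : 'M[R]_n) :
  continuous (fun u => dot (u *m M) u).
Proof.
apply: continuous_big => [|i _]; first exact: add_continuous.
move=> u; apply: continuousM; first exact: mulmx_coord_continuous.
exact: (@coord_continuous R 1 n 0 i).
Qed.

End dot.

Section spectral.
Variables (R : realType) (n : nat) (S : 'M[R]_n).
Hypothesis symS : S^T = S.

Let sphere k (V : 'M[R]_(k, n)) : set 'rV[R]_n :=
  [set u | dot u u = 1 /\ forall i, (u *m V^T) 0 i = 0].

Let sphere_compact k (V : 'M[R]_(k, n)) : compact (sphere V).
Proof.
pose A (_ : 'I_n) : set R := `[-1, 1]%classic.
apply: subclosed_compact (rV_compact (A := A) (fun _ => @segment_compact _ _ _)) _.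
  have -> : sphere V = [set u | dot u u = 1] `&`
      \bigcap_(i in [set: 'I_k]) [set u | (u *m V^T) 0 i = 0].
    apply/seteqP; split=> u /= [h1 h2]; split=> // i; last exact: h2.
    by move=> _; exact: h2.
  apply: closedI; last apply: closed_bigI => i _.
    apply: (@preimage_closed _ _ (fun u => dot u u) [set x | x = 1]) => [u _|].
      have := @quadratic_form_continuous R n 1%:M u.
      by under eq_fun do rewrite mulmx1.
    exact: closed_eq.
  apply: (@preimage_closed _ _ (fun u : 'rV[R]_n => (u *m V^T) 0 i) [set x | x = 0]) => [u _|].
    exact: mulmx_coord_continuous.
  exact: closed_eq.
move=> u /= [u1 _] i; rewrite /A /= in_itv /= -ler_norml.
rewrite -(@ler_pXn2r _ 2) ?nnegrE // expr1n -u1 real_normK ?num_real //.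
rewrite [X in _ <= X](bigD1 i) //= -expr2 lerDl.
by apply: sumr_ge0 => j _; rewrite -expr2 sqr_ge0.
Qed.

Let sphere_nonempty k (V : 'M[R]_(k, n)) : (k < n)%N -> sphere V !=set0.
Proof.
move=> kn; have kerN0 : kermx V^T != 0.
  rewrite -mxrank_eq0 mxrank_ker subn_eq0 -ltnNge mxrank_tr.
  exact: leq_ltn_trans (rank_leq_row V) kn.
have [v vker v0] := rowV0Pn kerN0.
have dv : 0 < dot v v by rewrite lt_neqAle eq_sym dot_eq0 v0 dot_sqr_ge0.
exists ((Num.sqrt (dot v v))^-1 *: v); split.
  rewrite dotZl dotZr mulrA -expr2 exprVn sqr_sqrtr ?ltW //.
  by rewrite mulVf ?gt_eqF.
move=> i; rewrite -scalemxAl (sub_kermxP vker) scaler0 mxE //.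
Qed.

(** On the unit sphere of the orthogonal complement of an invariant subspace, a
    maximiser [u] of the quadratic form is an eigenvector: the residual [r] of
    the eigenvalue equation stays in that complement, and moving from [u] in the
    direction [r] would increase the form to first order unless [r = 0]. *)
Let eigenvector_step k (V : 'M[R]_(k, n)) (d : 'rV[R]_k) :
  (k < n)%N -> V *m S = diag_mx d *m V ->
  exists (u : 'rV[R]_n) (mu : R),
    [/\ dot u u = 1, u *m V^T = 0 & u *m S = mu *: u].
Proof.
move=> kn VS.
have cf : {within sphere V, continuous (fun u => dot (u *m S) u)}.
  by apply: continuous_subspaceT; exact: quadratic_form_continuous.
have [u] := EVT_max_rV (@sphere_nonempty _ V kn) (@sphere_compact _ V) cf.
rewrite inE => -[u1 uV] umax; set mu := dot (u *m S) u.
have {}uV : u *m V^T = 0 by apply/rowP => i; rewrite uV mxE.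
exists u, mu; split=> //.
have ray w : w *m V^T = 0 -> dot (w *m S) w <= mu * dot w w.
  move=> wV; have [->|w0] := eqVneq w 0.
    by rewrite mul0mx /dot !big1 ?mulr0 // => j _; rewrite mxE mul0r.
  have dw : 0 < dot w w by rewrite lt_neqAle eq_sym dot_eq0 w0 dot_sqr_ge0.
  have s2 : (Num.sqrt (dot w w))^-1 * (Num.sqrt (dot w w))^-1 = (dot w w)^-1.
    by rewrite -expr2 exprVn sqr_sqrtr ?ltW.
  have := umax ((Num.sqrt (dot w w))^-1 *: w).
  rewrite inE -scalemxAl !dotZl !dotZr mulrA s2 ler_pdivrMl //.
  rewrite [mu * _]mulrC; apply; split.
    by rewrite dotZl dotZr mulrA s2 mulVf ?gt_eqF.
  by move=> i; rewrite -scalemxAl wV scaler0 mxE.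
have [r rE] : exists r, r = u *m S - mu *: u by exists (u *m S - mu *: u).
have rV : r *m V^T = 0.
  rewrite rE mulmxBl -scalemxAl uV scaler0 subr0 -mulmxA.
  have -> : S *m V^T = V^T *m (diag_mx d)^T by rewrite -trmx_mul -VS trmx_mul symS.
  by rewrite mulmxA uV mul0mx.
have ur : dot u r = 0.
  by rewrite rE dotDr -scaleNr dotZr u1 mulr1 dotC subrr.
have uSr : dot (u *m S) r = dot r r.
  by rewrite {2}rE dotDl -scaleNr dotZl ur mulr0 addr0.
have key e : 0 <= e -> 2 * e * dot r r <= e ^+ 2 * (mu * dot r r - dot (r *m S) r).
  move=> e0; have := ray (u + e *: r).
  rewrite mulmxDl -!scalemxAl uV rV scaler0 addr0 => /(_ erefl).
  rewrite mulmxDl -scalemxAl !dotDl !dotDr !dotZl !dotZr.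
  rewrite u1 ur (dotC r u) ur uSr -/mu.
  have -> : dot (r *m S) u = dot r r by rewrite dot_mulmx // dotC uSr.
  lra.
apply/eqP; rewrite -subr_eq0 -rE -dot_eq0; apply/eqP.
apply/eqP; rewrite eq_le dot_sqr_ge0 andbT leNgt; apply/negP => r0.
set K := mu * dot r r - dot (r *m S) r in key.
have K1 : 0 < `|K| + 1 by rewrite ltr_wpDl.
(* The step [x] is small enough for the linear gain to beat the quadratic term. *)
set x := dot r r / (`|K| + 1).
have xE : dot r r = x * (`|K| + 1) by rewrite /x divfK ?gt_eqF.
have x0 : 0 < x by rewrite divr_gt0.
have := key _ (ltW x0); rewrite xE => h.
have : 2 * (`|K| + 1) <= K.
  rewrite -(ler_pM2l (exprn_gt0 2 x0)); apply: le_trans h.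
  by rewrite le_eqVlt; apply/orP; left; apply/eqP; ring.
have := normr_ge0 K; have := ler_norm K; lra.
Qed.

Let spectral_rows k : (k <= n)%N -> exists (V : 'M[R]_(k, n)) (d : 'rV[R]_k),
  V *m V^T = 1%:M /\ V *m S = diag_mx d *m V.
Proof.
elim: k => [|k IH] kn.
  by exists (0 : 'M[R]_(0, n)), 0; split; apply/matrixP => -[].
have [V [d [VV VS]]] := IH (ltnW kn).
have [u [mu [u1 uV uS]]] := eigenvector_step kn VS.
have uu : u *m u^T = 1%:M.
  by apply/matrixP => i j; rewrite !ord1 -dotE u1 !mxE.
rewrite -addn1; exists (col_mx V u), (row_mx d (mu%:M : 'M[R]_1)); split.
  rewrite tr_col_mx mul_col_row VV uV uu.
  have -> : V *m u^T = 0 by rewrite -[V]trmxK -trmx_mul uV trmx0.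
  by rewrite -scalar_mx_block.
rewrite mul_col_mx VS uS diag_mx_row mul_block_col !mul0mx addr0 add0r.
congr col_mx; rewrite -mul_scalar_mx; congr (_ *m _).
by apply/matrixP => i j; rewrite !ord1 !mxE eqxx.
Qed.

(** The rows of [V] are an orthonormal eigenbasis. *)
Theorem real_spectral : exists (V : 'M[R]_n) (d : 'rV[R]_n),
  [/\ V *m V^T = 1%:M, V^T *m V = 1%:M & V *m S = diag_mx d *m V].
Proof.
have [V [d [h1 h2]]] := spectral_rows (leqnn n).
by exists V, d; split=> //; exact: mulmx1C.
Qed.

End spectral.

(** * The one-particle chain and its spectrum *)

(** The weighted eigenvalue problem [B phi = lam w phi] becomes an ordinary
    symmetric one after conjugation by the square roots of the weights. *)
Theorem weighted_spectral (R : realType) (T : finType) (w : T -> R)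
    (B : T -> T -> R) : (forall x, 0 < w x) -> (forall x y, B x y = B y x) ->
  exists (phi : 'I_#|T| -> T -> R) (lam : 'I_#|T| -> R),
  [/\ forall i j, \sum_x w x * (phi i x * phi j x) = (i == j)%:R,
      forall i x, \sum_y B x y * phi i y = lam i * (w x * phi i x) &
      forall f g : T -> R, \sum_x w x * (f x * g x) =
        \sum_i (\sum_x w x * (f x * phi i x)) * (\sum_x w x * (g x * phi i x))].
Proof.
move=> w_gt0 symB; pose s x := Num.sqrt (w x).
have s0 x : s x != 0 by rewrite gt_eqF // sqrtr_gt0.
have ss x : w x = s x * s x by rewrite -expr2 sqr_sqrtr // ltW.
have sumE (F : T -> R) : \sum_x F x = \sum_(j < #|T|) F (enum_val j).
  by rewrite -big_enum_val.
pose S : 'M[R]_#|T| := \matrix_(i, j)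
  (B (enum_val i) (enum_val j) / (s (enum_val i) * s (enum_val j))).
have symS : S^T = S.
  by apply/matrixP => i j; rewrite !mxE symB [s _ * s _]mulrC.
have [V [d [VVt VtV VS]]] := real_spectral symS.
pose phi i x := V i (enum_rank x) / s x.
pose up (f : T -> R) : 'rV[R]_#|T| := \row_j (s (enum_val j) * f (enum_val j)).
have innerE f i : \sum_x w x * (f x * phi i x) = (up f *m V^T) 0 i.
  rewrite sumE mxE; apply: eq_bigr => j _; rewrite !mxE /phi enum_valK ss.
  by field.
exists phi, (fun i => d 0 i); split.
- move=> i j; rewrite innerE.
  have -> : (up (phi i) *m V^T) 0 j = (V *m V^T) i j.
    rewrite !mxE; apply: eq_bigr => l _; rewrite !mxE /phi enum_valK.
    by congr (_ * _); field.
  by rewrite VVt mxE.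
- move=> i x; rewrite sumE.
  have := congr1 (fun M : 'M[R]_#|T| => M i (enum_rank x)) VS.
  rewrite mul_diag_mx !mxE => h.
  transitivity (s x * (d 0 i * V i (enum_rank x))); last first.
    by rewrite /phi ss; field.
  rewrite -h mulr_sumr; apply: eq_bigr => j _.
  by rewrite mxE /phi enum_valK enum_rankK symB; field; rewrite !s0.
move=> f g.
under [RHS]eq_bigr do rewrite !innerE.
transitivity (dot (up f) (up g)).
  by rewrite sumE; apply: eq_bigr => j _; rewrite !mxE ss; ring.
transitivity (dot (up f *m V^T) (up g *m V^T)) => //.
by rewrite !dotE trmx_mul trmxK mulmxA -(mulmxA _ V^T) VtV mulmx1.
Qed.

Section Graph.
Variables (R : realType) (G : wgraph R).
Implicit Types (x y z : G) (f g : G -> R).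

(** The factor that multiplies the edge weight in the Dirichlet form.  It is also
    the mass that an averaging of [xy] moves per unit of density difference. *)
Definition conduct x y : R := site x * site y / (site x + site y).

Definition inner f g : R := \sum_x site x * (f x * g x).

Lemma vertex_exists : exists x : G, True.
Proof.
case: (pickP [pred x : G | true]) => [x _|G0]; first by exists x.
have := site_sum G; rewrite big_pred0 // => /eqP.
by rewrite eq_sym oner_eq0.
Qed.

Lemma siteD_gt0 x y : 0 < site x + site y.
Proof. by rewrite addr_gt0 ?site_gt0. Qed.

Lemma conductC x y : conduct x y = conduct y x.
Proof. by rewrite /conduct [site x * _]mulrC [site x + _]addrC. Qed.

Lemma conduct_gt0 x y : 0 < conduct x y.
Proof. by rewrite divr_gt0 ?siteD_gt0 // mulr_gt0 ?site_gt0. Qed.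

Lemma sum_edges_ge0 (F : G -> G -> R) :
  (forall x y, edge x y -> 0 <= F x y) -> 0 <= sum_edges F.
Proof.
move=> F0; apply: mulr_ge0; first by rewrite invr_ge0 ler0n.
by apply: sumr_ge0 => x _; apply: sumr_ge0 => y; exact: F0.
Qed.

Lemma eq_sum_edges (F F' : G -> G -> R) :
  (forall x y, edge x y -> F x y = F' x y) -> sum_edges F = sum_edges F'.
Proof.
move=> FF'; congr (_ * _); apply: eq_bigr => x _.
by apply: eq_bigr => y; exact: FF'.
Qed.

Lemma ler_sum_edges (F F' : G -> G -> R) :
  (forall x y, edge x y -> F x y <= F' x y) -> sum_edges F <= sum_edges F'.
Proof.
move=> FF'; rewrite ler_pM2l ?invr_gt0 ?ltr0n //.
by apply: ler_sum => x _; apply: ler_sum => y; exact: FF'.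
Qed.

Lemma sum_edgesD (F F' : G -> G -> R) :
  sum_edges (fun x y => F x y + F' x y) = sum_edges F + sum_edges F'.
Proof.
rewrite -mulrDr -big_split; congr (_ * _); apply: eq_bigr => x _.
by rewrite -big_split.
Qed.

Lemma sum_edgesZ (a : R) (F : G -> G -> R) :
  sum_edges (fun x y => a * F x y) = a * sum_edges F.
Proof.
rewrite /sum_edges mulrCA; congr (_ * _); rewrite mulr_sumr.
by apply: eq_bigr => x _; rewrite mulr_sumr.
Qed.

Lemma sum_edges_sum (I : finType) (P : pred I) (F : I -> G -> G -> R) :
  sum_edges (fun x y => \sum_(i | P i) F i x y) = \sum_(i | P i) sum_edges (F i).
Proof.
rewrite -mulr_sumr; congr (_ * _); rewrite exchange_big /=.
by apply: eq_bigr => x _; rewrite exchange_big.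
Qed.

Lemma sum_edges_flip (F : G -> G -> R) :
  \sum_x \sum_(y | edge x y) F x y = \sum_x \sum_(y | edge x y) F y x.
Proof.
rewrite (exchange_big_dep xpredT) //=; apply: eq_bigr => x _.
by apply: eq_bigl => y; rewrite edge_sym.
Qed.

(** Reversibility: both orientations of an edge contribute the same weight. *)
Lemma inner_gen f g : inner f (bin1_gen g) =
  - sum_edges (fun x y => weight x y * conduct x y * (f x - f y) * (g x - g y)).
Proof.
pose F x y : R := weight x y * conduct x y * (f x * (g y - g x)).
have -> : inner f (bin1_gen g) = \sum_x \sum_(y | edge x y) F x y.
  apply: eq_bigr => x _; rewrite !mulr_sumr; apply: eq_bigr => y _.
  by rewrite /F /conduct; field; rewrite gt_eqF ?siteD_gt0.
apply: (@mulfI _ 2); first by rewrite pnatr_eq0.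
rewrite mulrN mulrA divff ?pnatr_eq0 // mul1r mulr_natl mulr2n.
rewrite {2}sum_edges_flip -big_split -sumrN; apply: eq_bigr => x _ /=.
rewrite -big_split -sumrN; apply: eq_bigr => y _ /=.
by rewrite /F (weight_sym y) (conductC y); ring.
Qed.

Lemma dirichletE f : bin1_dirichlet f = - inner f (bin1_gen f).
Proof.
by rewrite inner_gen opprK; apply: eq_sum_edges => x y _; rewrite /conduct; ring.
Qed.

Lemma dirichlet_ge0 f : 0 <= bin1_dirichlet f.
Proof.
apply: sum_edges_ge0 => x y exy; rewrite mulr_ge0 ?sqr_ge0 // mulr_ge0 //.
  exact/ltW/weight_gt0.
exact/ltW/conduct_gt0.
Qed.

Lemma gen_sym f g : inner f (bin1_gen g) = inner (bin1_gen f) g.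
Proof.
have -> : inner (bin1_gen f) g = inner g (bin1_gen f).
  by apply: eq_bigr => x _; rewrite (mulrC (g x)).
by rewrite !inner_gen; congr (- _); apply: eq_sum_edges => x y _; ring.
Qed.

(** Zero energy forces equality across each edge, and the graph is connected. *)
Lemma dirichlet_eq0 f : bin1_dirichlet f = 0 -> forall x y, f x = f y.
Proof.
move=> f0 x y; have step a b : edge a b -> f a = f b.
  move=> eab; apply/eqP; rewrite -subr_eq0 -sqrf_eq0.
  have cw a' b' : edge a' b' -> 0 < weight a' b' * conduct a' b'.
    by move=> e; rewrite mulr_gt0 ?weight_gt0 ?conduct_gt0.
  pose E a' b' := weight a' b' * conduct a' b' * (f a' - f b') ^+ 2.
  have E0 a' b' : edge a' b' -> 0 <= E a' b'.
    by move=> e; rewrite mulr_ge0 ?sqr_ge0 // ltW ?cw.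
  have /eqP : \sum_x \sum_(y | edge x y) E x y = 0.
    move/eqP: f0; rewrite /bin1_dirichlet /sum_edges mulf_eq0 invr_eq0.
    by rewrite pnatr_eq0 /= => /eqP.
  rewrite psumr_eq0 => [/allP/(_ a (mem_index_enum a))/=|u _]; last first.
    by apply: sumr_ge0 => v; apply: E0.
  rewrite psumr_eq0 => [/allP/(_ b (mem_index_enum b))|v]; last exact: E0.
  by rewrite eab /= /E mulf_eq0 gt_eqF ?cw.
have /connectP[p] := edge_connected x y.
elim: p x => [x _ ->//|z p IH x /= /andP[exz pz] yl].
by rewrite (step _ _ exz); apply: IH.
Qed.

(** The third clause is Parseval's identity: the eigenfunctions span all
    functions on the vertices. *)
Theorem eigenbasis : exists (phi : 'I_#|G| -> G -> R) (lam : 'I_#|G| -> R),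
  [/\ forall i j, inner (phi i) (phi j) = (i == j)%:R,
      forall i x, - bin1_gen (phi i) x = lam i * phi i x &
      forall f g, inner f g = \sum_i inner f (phi i) * inner g (phi i)].
Proof.
(* The symmetric matrix of the Dirichlet form. *)
pose B x y : R := (x == y)%:R * (\sum_(z | edge x z) weight x z * conduct x z)
  - (edge x y)%:R * (weight x y * conduct x y).
have symB x y : B x y = B y x.
  rewrite /B edge_sym weight_sym conductC eq_sym.
  by case: eqVneq => [->|]; rewrite ?mul0r.
have BE f x : \sum_y B x y * f y = - (site x * bin1_gen f x).
  transitivity (\sum_(y | edge x y) weight x y * conduct x y * (f x - f y)).
    transitivity (\sum_y (x == y)%:R * (\sum_(z | edge x z) weight x z * conduct x z)
        * f y - \sum_y (edge x y)%:R * (weight x y * conduct x y) * f y).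
      by rewrite -sumrB; apply: eq_bigr => y _; rewrite /B mulrBl.
    transitivity ((\sum_(z | edge x z) weight x z * conduct x z) * f x
        - \sum_(y | edge x y) weight x y * conduct x y * f y).
      congr (_ - _).
        rewrite (bigD1 x) //= eqxx mul1r [X in _ + X]big1 ?addr0 // => y yx.
        by rewrite eq_sym (negbTE yx) !mul0r.
      rewrite (bigID (edge x)) /= [X in _ + X]big1 ?addr0.
        by apply: eq_bigr => y ->; rewrite mul1r.
      by move=> y /negbTE ->; rewrite !mul0r.
    by rewrite mulr_suml -sumrB; apply: eq_bigr => y _; rewrite mulrBr.
  rewrite mulr_sumr -sumrN; apply: eq_bigr => y _.
  by rewrite /conduct; field; rewrite gt_eqF ?siteD_gt0.
have [phi [lam [h1 h2 h3]]] := weighted_spectral (@site_gt0 R G) symB.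
exists phi, lam; split=> // i x.
have := h2 i x; rewrite BE -mulrN mulrCA => /mulfI; apply.
by rewrite gt_eqF ?site_gt0.
Qed.

End Graph.

Section Spectrum.
Variables (R : realType) (G : wgraph R).
Variables (phi : 'I_#|G| -> G -> R) (lam : 'I_#|G| -> R).
Hypothesis phi_ortho : forall i j, inner (phi i) (phi j) = (i == j)%:R.
Hypothesis phi_eigen : forall i x, - bin1_gen (phi i) x = lam i * phi i x.
Hypothesis parseval :
  forall f g, inner f g = \sum_i inner f (phi i) * inner g (phi i).

Implicit Types (f g : G -> R) (x y : G).

Lemma inner_genr f i : inner f (bin1_gen (phi i)) = - lam i * inner f (phi i).
Proof.
rewrite /inner mulr_sumr; apply: eq_bigr => x _.
by rewrite -[bin1_gen _ _]opprK phi_eigen; ring.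
Qed.

Lemma dirichlet_spectral f :
  bin1_dirichlet f = \sum_i lam i * inner f (phi i) ^+ 2.
Proof.
rewrite dirichletE parseval -sumrN; apply: eq_bigr => i _.
by rewrite -gen_sym inner_genr; ring.
Qed.

Lemma eigenvalueE i : lam i = bin1_dirichlet (phi i).
Proof. by rewrite dirichletE inner_genr phi_ortho eqxx mulr1 opprK. Qed.

Lemma eigenvalue_ge0 i : 0 <= lam i.
Proof. by rewrite eigenvalueE dirichlet_ge0. Qed.

Lemma eigenvalue_const i : lam i <= 0 -> forall x y, phi i x = phi i y.
Proof.
move=> li; apply: dirichlet_eq0; rewrite -eigenvalueE.
by apply/eqP; rewrite eq_le li eigenvalue_ge0.
Qed.

Lemma inner_self_eq0 f : inner f f = 0 -> forall x, f x = 0.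
Proof.
move/eqP; rewrite psumr_eq0 => [/allP f0 x|x _]; last first.
  by rewrite mulr_ge0 -?expr2 ?sqr_ge0 // ltW ?site_gt0.
have := f0 x (mem_index_enum x).
by rewrite /= mulf_eq0 mulf_eq0 orbb gt_eqF ?site_gt0 //= => /eqP.
Qed.

(** An eigenfunction pairs to zero with every basis element of a different
    eigenvalue, and it cannot pair to zero with all of them. *)
Lemma eigenvalue_listed mu : bin1_eigenvalue G mu -> exists i, lam i = mu.
Proof.
move=> [psi [x0 psix0] psi_eigen].
have [i psii] : exists i, inner psi (phi i) != 0.
  apply/existsP; apply: contraNT psix0; rewrite negb_exists => /forallP all0.
  apply/eqP/inner_self_eq0; rewrite parseval big1 // => i _.
  by have := all0 i; rewrite negbK => /eqP ->; rewrite mul0r.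
exists i; apply: (mulIf psii).
transitivity (- inner psi (bin1_gen (phi i))); first by rewrite inner_genr; ring.
rewrite gen_sym -sumrN mulr_sumr; apply: eq_bigr => x _.
by rewrite -[bin1_gen _ _]opprK psi_eigen; ring.
Qed.

Lemma constant_inner (a b : R) (f g : G -> R) :
  (forall x, f x = a) -> (forall x, g x = b) -> inner f g = a * b.
Proof.
move=> fa gb; rewrite /inner -[RHS]mul1r -(site_sum G) mulr_suml.
by apply: eq_bigr => x _; rewrite fa gb.
Qed.

Lemma eigenbasis_eigenvalue i : bin1_eigenvalue G (lam i).
Proof.
exists (phi i); last exact: phi_eigen.
apply/existsP; apply: contraT; rewrite negb_exists => /forallP all0.
have phi0 x : phi i x = 0 by have := all0 x; rewrite negbK => /eqP.
have /eqP := phi_ortho i i; rewrite eqxx (constant_inner phi0 phi0) mul0r.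
by rewrite eq_sym oner_eq0.
Qed.

Hypothesis card_gt1 : (1 < #|G|)%N.

(** If every eigenvalue vanished, two orthonormal eigenfunctions would both be
    constant. *)
Lemma positive_eigenvalue : exists i, 0 < lam i.
Proof.
apply/existsP; apply: contraT; rewrite negb_exists => /forallP all0.
have [x0 _] := vertex_exists G.
pose i : 'I_#|G| := Ordinal (ltnW card_gt1); pose j := Ordinal card_gt1.
have cst k x : phi k x = phi k x0.
  by apply: eigenvalue_const; rewrite leNgt all0.
have E k l : inner (phi k) (phi l) = phi k x0 * phi l x0.
  by apply: constant_inner => x.
have := phi_ortho i i; have := phi_ortho j j; have := phi_ortho i j.
rewrite !E !eqxx; have -> : (i == j) = false by [].
move=> /eqP; rewrite mulf_eq0 => /orP[] /eqP -> ; rewrite ?mul0r.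
  by move=> _ /eqP; rewrite eq_sym oner_eq0.
by move=> /eqP; rewrite eq_sym oner_eq0.
Qed.

(** Only the finitely many [lam] can be eigenvalues, so the infimum that defines
    the gap is a minimum. *)
Lemma gap_attained : exists2 i, lam i = gap G &
  0 < gap G /\ forall j, 0 < lam j -> gap G <= lam j.
Proof.
have [i0 i0P] := positive_eigenvalue.
pose i := [arg min_(k < i0 | 0 < lam k) lam k]%O.
have [li lmin] : 0 < lam i /\ forall j, 0 < lam j -> lam i <= lam j.
  by rewrite /i; case: arg_minP => // k; split.
have -> : gap G = lam i.
  apply/eqP; rewrite eq_le; apply/andP; split.
    apply: ge_inf; first by exists 0 => mu [/ltW].
    by split=> //; exact: eigenbasis_eigenvalue.
  apply: lb_le_inf.
    by exists (lam i); split=> //; exact: eigenbasis_eigenvalue.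
  by move=> mu [mu0 /eigenvalue_listed[j jmu]]; rewrite -jmu lmin // jmu.
by exists i.
Qed.

End Spectrum.

(** * The averaging generator on linear and quadratic functions *)

Section Generator.
Variables (R : realType) (G : wgraph R).
Implicit Types (x y z : G) (f g : G -> R) (eta : simplex G).

Definition pairing f eta : R := \sum_z eta z * f z.

Definition sq_density eta : R := \sum_z eta z ^+ 2 / site z.

Lemma pairingE f eta : pairing f eta = inner (rel_density eta) f.
Proof.
apply: eq_bigr => z _; rewrite /rel_density.
by field; rewrite gt_eqF ?site_gt0.
Qed.

Lemma sq_densityE eta : sq_density eta = inner (rel_density eta) (rel_density eta).
Proof.
apply: eq_bigr => z _; rewrite /rel_density.
by field; rewrite gt_eqF ?site_gt0.
Qed.

Lemma sum_avg_update (H : G -> R -> R) x y eta : x != y ->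
  \sum_z H z (avg_update x y eta z) - \sum_z H z (eta z) =
  (H x (site x / (site x + site y) * (eta x + eta y)) - H x (eta x)) +
  (H y (site y / (site x + site y) * (eta x + eta y)) - H y (eta y)).
Proof.
move=> xy; rewrite -sumrB (bigD1 x) //= (bigD1 y) 1?eq_sym //=.
rewrite big1 ?addr0 /avg_mass ?eqxx; first by rewrite eq_sym (negbTE xy).
by move=> z /andP[/negbTE -> /negbTE ->]; rewrite subrr.
Qed.

Lemma edge_neq x y : edge x y -> x != y.
Proof. by apply: contraTneq => ->; rewrite edge_irr. Qed.

Lemma pairing_update f x y eta : x != y ->
  pairing f (avg_update x y eta) - pairing f eta =
  conduct x y * (rel_density eta x - rel_density eta y) * (f y - f x).
Proof.
move=> xy; rewrite (sum_avg_update (fun z m => m * f z)) // /conduct /rel_density.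
by field; rewrite !gt_eqF ?site_gt0 ?siteD_gt0.
Qed.

Lemma sq_density_update x y eta : x != y ->
  sq_density (avg_update x y eta) - sq_density eta =
  - (conduct x y * (rel_density eta x - rel_density eta y) ^+ 2).
Proof.
move=> xy; rewrite (sum_avg_update (fun z m => m ^+ 2 / site z)) //.
rewrite /conduct /rel_density.
by field; rewrite !gt_eqF ?site_gt0 ?siteD_gt0.
Qed.

(** The mean of the averaging process follows the one-particle chain. *)
Lemma avg_gen_pairing f eta :
  avg_gen (pairing f) eta = pairing (bin1_gen f) eta.
Proof.
rewrite pairingE inner_gen -mulN1r -sum_edgesZ; apply: eq_sum_edges => x y exy.
by rewrite pairing_update ?edge_neq //; ring.
Qed.

(** Averaging an edge removes exactly the energy of that edge, which is half of
    what the heat flow dissipates. *)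
Lemma avg_gen_sq_density eta :
  avg_gen (@sq_density) eta = - bin1_dirichlet (rel_density eta).
Proof.
rewrite -mulN1r -sum_edgesZ; apply: eq_sum_edges => x y exy.
by rewrite sq_density_update ?edge_neq // /conduct; ring.
Qed.

(** The square of a mode decays at twice its rate, up to the noise of the
    updates, given by the sum over the edges. *)
Lemma avg_gen_pairing_sq f (mu : R) eta :
  (forall x, - bin1_gen f x = mu * f x) ->
  avg_gen (fun eta => pairing f eta ^+ 2) eta =
  - 2 * mu * pairing f eta ^+ 2 +
  sum_edges (fun x y => weight x y * (conduct x y ^+ 2 *
    (rel_density eta x - rel_density eta y) ^+ 2 * (f x - f y) ^+ 2)).
Proof.
move=> f_eigen.
have pf : pairing (bin1_gen f) eta = - mu * pairing f eta.
  rewrite mulr_sumr; apply: eq_bigr => z _.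
  by rewrite -[bin1_gen _ _]opprK f_eigen; ring.
have -> : - 2 * mu * pairing f eta ^+ 2 =
    (2 * pairing f eta) * avg_gen (pairing f) eta.
  by rewrite avg_gen_pairing pf; ring.
rewrite -sum_edgesZ -sum_edgesD; apply: eq_sum_edges => x y exy.
have := pairing_update f eta (edge_neq exy).
by move/eqP; rewrite subr_eq => /eqP ->; ring.
Qed.

Lemma avg_gen_sum (I : finType) (P : pred I) (F : I -> simplex G -> R) eta :
  avg_gen (fun eta => \sum_(i | P i) F i eta) eta =
  \sum_(i | P i) avg_gen (F i) eta.
Proof.
rewrite -sum_edges_sum; apply: eq_sum_edges => x y _.
by rewrite -sumrB mulr_sumr.
Qed.

Lemma avg_genD (F F' : simplex G -> R) eta :
  avg_gen (fun eta => F eta + F' eta) eta = avg_gen F eta + avg_gen F' eta.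
Proof. by rewrite -sum_edgesD; apply: eq_sum_edges => x y _; ring. Qed.

Lemma avg_genZ (a : R) (F : simplex G -> R) eta :
  avg_gen (fun eta => a * F eta) eta = a * avg_gen F eta.
Proof. by rewrite -sum_edgesZ; apply: eq_sum_edges => x y _; ring. Qed.

Lemma avg_gen_cst (a : R) eta : avg_gen (fun _ => a) eta = 0.
Proof.
rewrite /avg_gen /sum_edges big1 ?mulr0 // => x _.
by rewrite big1 // => y _; rewrite subrr mulr0.
Qed.

Lemma mass_le1 eta x : eta x <= 1.
Proof.
rewrite -(mass_sum eta) (bigD1 x) //= lerDl.
by apply: sumr_ge0 => z _; apply: mass_ge0.
Qed.

End Generator.

(** * The averaging semigroup and the process *)

Section Semigroup.
Variables (R : realType) (G : wgraph R).
Implicit Types (f g h : simplex G -> R) (eta : simplex G).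

Definition bounded_fct f := exists M : R, forall eta, `|f eta| <= M.

(** A bound for the norm of the generator on bounded functions. *)
Let rate : R := 2 * sum_edges (@weight R G).

Let rate_ge0 : 0 <= rate.
Proof.
apply: mulr_ge0 => //; apply: sum_edges_ge0 => x y exy.
exact/ltW/weight_gt0.
Qed.

Lemma avg_gen_le f M eta :
  (forall eta, `|f eta| <= M) -> `|avg_gen f eta| <= rate * M.
Proof.
move=> fM; have fM' eta' : - M <= f eta' <= M by rewrite -ler_norml.
have -> : rate * M = sum_edges (fun x y : G => (2 * M) * weight x y).
  by rewrite sum_edgesZ /rate; ring.
have aux (x y : G) : edge x y ->
    `|weight x y * (f (avg_update x y eta) - f eta)| <= 2 * M * weight x y.
  move=> exy; rewrite normrM gtr0_norm ?weight_gt0 // mulrC.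
  rewrite ler_pM2r ?weight_gt0 // (le_trans (ler_normB _ _)) //.
  by have := fM eta; have := fM (avg_update x y eta); lra.
rewrite ler_norml -mulN1r -sum_edgesZ; apply/andP; split.
  by apply: ler_sum_edges => x y /aux; rewrite ler_norml mulN1r => /andP[].
by apply: ler_sum_edges => x y /aux; rewrite ler_norml => /andP[].
Qed.

Lemma bounded_avg_gen f : bounded_fct f -> bounded_fct (avg_gen f).
Proof. by case=> M fM; exists (rate * M) => eta; apply: avg_gen_le. Qed.

Let coef f eta m : R := (m`!%:R)^-1 * iter m (@avg_gen R G) f eta.

Let iter_avg_gen_le f M m eta : (forall eta, `|f eta| <= M) ->
  `|iter m (@avg_gen R G) f eta| <= rate ^+ m * M.
Proof.
move=> fM; elim: m eta => [|m IH] eta; first by rewrite mul1r.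
by rewrite iterS exprS -mulrA; apply: avg_gen_le.
Qed.

Let cvg_coef f eta K : bounded_fct f -> cvgn (pseries (coef f eta) K).
Proof.
case=> M fM; apply: normed_cvg.
apply: (@series_le_cvg _ _ (fun m => M * exp_coeff (rate * `|K|) m)).
- by move=> m; exact: normr_ge0.
- move=> m; apply: mulr_ge0; first by rewrite (le_trans _ (fM eta)).
  by apply: exp_coeff_ge0; apply: mulr_ge0.
- move=> m /=; rewrite /coef /exp_coeff /= !normrM normfV normr_nat normrX.
  rewrite exprMn mulrA [M * _]mulrC.
  rewrite [leLHS](_ : _ = `|iter m (avg_gen (G:=G)) f eta| * (`|K| ^+ m / m`!%:R)).
    rewrite [leRHS](_ : _ = (rate ^+ m * M) * (`|K| ^+ m / m`!%:R)); last ring.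
    rewrite ler_wpM2r ?iter_avg_gen_le // divr_ge0 ?exprn_ge0 //.
  by ring.
apply: is_cvg_seriesZ; exact: is_cvg_series_exp_coeff.
Qed.

Let semigroupE f eta t : avg_semigroup t f eta = limn (pseries (coef f eta) t).
Proof.
rewrite /avg_semigroup /pseries; congr (limn (series _)).
by apply/funext => m; rewrite /coef /=; ring.
Qed.

Let coef_diffs f eta : pseries_diffs (coef f eta) = coef (avg_gen f) eta.
Proof.
apply/funext => m; rewrite /pseries_diffs /coef iterSr factS natrM invfM.
by rewrite !mulrA divff ?mul1r // pnatr_eq0.
Qed.

(** Termwise differentiation shifts the coefficients of the series, that is, it
    replaces [f] by [avg_gen f]. *)
Lemma is_derive_semigroup f eta (t : R) : bounded_fct f ->
  is_derive t (1 : R) (fun t : R => avg_semigroup t f eta)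
    (avg_semigroup t (avg_gen f) eta).
Proof.
move=> fb; rewrite semigroupE.
have -> : (fun t => avg_semigroup t f eta) = (fun t => limn (pseries (coef f eta) t)).
  by apply/funext => u; rewrite semigroupE.
rewrite -coef_diffs; apply: (@pseries_snd_diffs _ _ (`|t| + 1)).
- exact: cvg_coef.
- by rewrite coef_diffs; apply/cvg_coef/bounded_avg_gen.
- by rewrite !coef_diffs; apply/cvg_coef/bounded_avg_gen/bounded_avg_gen.
- by rewrite [ltRHS]ger0_norm ?addr_ge0 // ltrDl.
Qed.

Lemma semigroup0 f eta : avg_semigroup 0 f eta = f eta.
Proof.
apply/cvg_lim => //; apply/cvg_ballP => e e0; near=> m.
suff -> : series (fun m => 0 ^+ m / m`!%:R * iter m (avg_gen (G:=G)) f eta) m = f eta.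
  exact: ballxx.
have m0 : (0 < m)%N by near: m; exists 1%N.
rewrite /series /= -(prednK m0) big_nat_recl // fact0 divr1 mul1r big1 ?addr0 //.
by move=> i _; rewrite expr0n !mul0r.
Unshelve. all: by end_near. Qed.

Lemma semigroup_eigen f (mu : R) eta t : (forall eta, avg_gen f eta = mu * f eta) ->
  avg_semigroup t f eta = expR (mu * t) * f eta.
Proof.
move=> fmu; rewrite /avg_semigroup.
have iterE m eta' : iter m (avg_gen (G:=G)) f eta' = mu ^+ m * f eta'.
  elim: m eta' => [|m IH] eta'; first by rewrite mul1r.
  rewrite iterS.
  have -> : iter m (avg_gen (G:=G)) f = (fun eta => mu ^+ m * f eta).
    by apply/funext.
  by rewrite avg_genZ fmu exprSr mulrA.
have -> : (fun m => t ^+ m / m`!%:R * iter m (avg_gen (G:=G)) f eta) =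
    (f eta) *: exp_coeff (mu * t).
  apply/funext => m; rewrite iterE -[RHS]/(f eta * ((mu * t) ^+ m / m`!%:R)) exprMn.
  by ring.
transitivity (f eta *: limn (series (exp_coeff (mu * t)))).
  by apply: lim_seriesZ; exact: is_cvg_series_exp_coeff.
exact: (mulrC (f eta) (expR (mu * t))).
Qed.

Section Measurability.

Lemma measurable_coord (x : G) :
  measurable_fun [set: simplex G] (fun eta : simplex G => eta x).
Proof.
move=> _ B mB; rewrite setTI; apply: sub_sigma_algebra.
by exists x, B.
Qed.

Lemma simplex_ext (eta eta' : simplex G) : (forall x, eta x = eta' x) -> eta = eta'.
Proof.
case: eta eta' => [m m0 m1] [m' m'0 m'1] /= mm'.
have E : m = m' by apply/funext.
by subst m'; congr Simplex; exact: Prop_irrelevance.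
Qed.

Lemma measurable_singleton (eta0 : simplex G) :
  measurable [set eta : simplex G | eta = eta0].
Proof.
have -> : [set eta : simplex G | eta = eta0] =
    \bigcap_(x in [set: G]) ((fun eta : simplex G => eta x) @^-1` [set eta0 x]).
  apply/seteqP; split=> [eta -> x _ //|eta h].
  by apply: simplex_ext => x; exact: h.
apply: fin_bigcap_measurable => // x _.
by rewrite -[X in measurable X]setTI; apply: measurable_coord.
Qed.

Lemma measurable_avg_update (x y : G) :
  measurable_fun [set: simplex G] (avg_update x y).
Proof.
apply: (@measurability _ _ _ _ _ _ (@coord_events R G)) => //.
move=> _ [_ [z [B [mB ->]]] <-].
have mf : measurable_fun [set: simplex G] (fun eta : simplex G => avg_mass x y eta z).
  rewrite /avg_mass; case: eqP => _.
    by apply: measurable_funM => //; apply: measurable_funD; apply: measurable_coord.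
  case: eqP => _; last exact: measurable_coord.
  by apply: measurable_funM => //; apply: measurable_funD; apply: measurable_coord.
exact: mf.
Qed.

(** The test functions for which the Markov property is stated. *)
Definition observable f := measurable_fun [set: simplex G] f /\ bounded_fct f.

Lemma observable_cst (a : R) : observable (fun _ => a).
Proof. by split; [exact: measurable_cst | exists `|a|]. Qed.

Lemma observableD f g : observable f -> observable g ->
  observable (fun eta => f eta + g eta).
Proof.
move=> [mf [M fM]] [mg [N gN]]; split; first exact: measurable_funD.
by exists (M + N) => eta; rewrite (le_trans (ler_normD _ _)) // lerD.
Qed.

Lemma observableM f g : observable f -> observable g ->
  observable (fun eta => f eta * g eta).
Proof.
move=> [mf [M fM]] [mg [N gN]]; split; first exact: measurable_funM.
by exists (M * N) => eta; rewrite normrM ler_pM.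
Qed.

Lemma observableZ (a : R) f : observable f -> observable (fun eta => a * f eta).
Proof. by move=> of_; apply: observableM => //; exact: observable_cst. Qed.

Lemma observable_sum (I : Type) (r : seq I) (P : pred I) (F : I -> simplex G -> R) :
  (forall i, observable (F i)) -> observable (fun eta => \sum_(i <- r | P i) F i eta).
Proof.
move=> oF; elim: r => [|i r IH].
  by under eq_fun do rewrite big_nil; exact: observable_cst.
under eq_fun do rewrite big_cons.
by case: (P i) => //; apply: observableD.
Qed.

Lemma observable_coord (x : G) : observable (fun eta : simplex G => eta x).
Proof.
split; first exact: measurable_coord.
by exists 1 => eta; rewrite ger0_norm ?mass_ge0 ?mass_le1.
Qed.

Lemma observable_pairing (f : G -> R) : observable (pairing f).
Proof.
apply: observable_sum => x; apply: observableM; last exact: observable_cst.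
exact: observable_coord.
Qed.

Lemma observable_sq_density : observable (@sq_density R G).
Proof.
apply: observable_sum => x; apply: observableM; last exact: observable_cst.
by apply: observableM; exact: observable_coord.
Qed.

Lemma observable_avg_gen f : observable f -> observable (avg_gen f).
Proof.
move=> [mf [M fM]].
apply: observableZ; apply: observable_sum => x; apply: observable_sum => y.
apply: observableZ; apply: observableD; last first.
  under eq_fun do rewrite -mulN1r.
  by apply: observableZ; split => //; exists M.
by split; [exact: (measurableT_comp mf (measurable_avg_update x y)) | exists M].
Qed.

End Measurability.

Section Expectation.
Variables (eta0 : simplex G) (P : averaging_process eta0).
Local Notation mu := (avg_prob P).

Lemma integrable_observable f (t : R) : observable f ->
  mu.-integrable [set: avg_space P] (EFin \o (fun w => f (avg_state P t w))).
Proof.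
move=> [mf [M fM]]; apply: measurable_bounded_integrable => //.
- by rewrite [X in (X < _)%E]probability_setT ltry.
- by apply: measurableT_comp => //; exact: avg_measurable.
exists M; split; first exact: num_real.
by move=> x Mx w _ /=; rewrite (le_trans (fM _)) // ltW.
Qed.

(** The Markov property at time 0, applied on the almost sure event that the
    process starts at [eta0]. *)
Lemma semigroup_expectation f (t : R) : 0 <= t -> observable f ->
  (\int[mu]_w (f (avg_state P t w))%:E)%E = (avg_semigroup t f eta0)%:E.
Proof.
move=> t0 of_; have [mf fb] := of_.
pose A := [set w | avg_state P 0 w = eta0].
have mS : measurable A.
  rewrite -[A]setTI.
  exact: (@avg_measurable _ _ _ P 0 measurableT _ (measurable_singleton eta0)).
have A1 : mu A = 1%E := avg_initial P.
have Ac0 : mu (~` A) = 0%E by rewrite probability_setC // A1 subee.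
have -> : (\int[mu]_w (f (avg_state P t w))%:E)%E =
    (\int[mu]_(w in A) (f (avg_state P t w))%:E)%E.
  rewrite (@negligible_integral _ _ _ mu _ (~` A)) //; last 2 first.
  - exact: measurableC.
  - exact: integrable_observable.
  by rewrite setTD setCK.
have Asig : (<<s \bigcup_(u in [set u : R | 0 <= u /\ u <= 0])
    g_sigma_algebra_preimage (avg_state P u) >>) A.
  apply: sub_sigma_algebra; exists 0 => //=.
  exists [set eta | eta = eta0]; first exact: measurable_singleton.
  by rewrite setTI.
rewrite (avg_markov (lexx 0) t0 mf fb Asig) subr0.
rewrite (eq_integral (fun _ => (avg_semigroup t f eta0)%:E)); last first.
  by move=> w; rewrite inE => ->.
by rewrite integral_cst // [X in (_ * X)%E]A1 mule1.
Qed.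

Lemma semigroup_Rintegral f (t : R) : 0 <= t -> observable f ->
  avg_semigroup t f eta0 = \int[mu]_w f (avg_state P t w).
Proof. by move=> t0 of_; rewrite /Rintegral semigroup_expectation. Qed.

Lemma semigroup_le f g (t : R) : 0 <= t -> observable f -> observable g ->
  (forall eta, f eta <= g eta) -> avg_semigroup t f eta0 <= avg_semigroup t g eta0.
Proof.
move=> t0 of_ og fg; rewrite !semigroup_Rintegral //.
by apply: le_Rintegral => //; exact: integrable_observable.
Qed.

Lemma semigroupD f g (t : R) : 0 <= t -> observable f -> observable g ->
  avg_semigroup t (fun eta => f eta + g eta) eta0 =
  avg_semigroup t f eta0 + avg_semigroup t g eta0.
Proof.
move=> t0 of_ og; rewrite !semigroup_Rintegral ?RintegralD //.
- exact: integrable_observable.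
- exact: integrable_observable.
- exact: observableD.
Qed.

Lemma semigroupZ a f (t : R) : 0 <= t -> observable f ->
  avg_semigroup t (fun eta => a * f eta) eta0 = a * avg_semigroup t f eta0.
Proof.
move=> t0 of_; rewrite !semigroup_Rintegral ?RintegralZl //.
- exact: integrable_observable.
- exact: observableZ.
Qed.

Lemma semigroup_cst (a t : R) : avg_semigroup t (fun _ => a) eta0 = a.
Proof.
rewrite (@semigroup_eigen _ 0) ?mul0r ?expR0 ?mul1r // => eta.
by rewrite avg_gen_cst ?mul0r.
Qed.

Lemma observable_affine a b f : observable f -> observable (fun eta => a * f eta + b).
Proof. by move=> of_; apply: observableD; [exact: observableZ | exact: observable_cst]. Qed.

Lemma semigroup_affine a b f (t : R) : 0 <= t -> observable f ->
  avg_semigroup t (fun eta => a * f eta + b) eta0 = a * avg_semigroup t f eta0 + b.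
Proof.
move=> t0 of_; rewrite semigroupD //; last 2 first.
- exact: observableZ.
- exact: observable_cst.
by rewrite semigroup_cst semigroupZ.
Qed.

End Expectation.

End Semigroup.

(** * Differential inequalities *)

Section ODE.
Variable R : realType.
Implicit Types (u v du : R -> R) (a b c x : R).

Lemma is_derive_mul u v x a b : is_derive x (1 : R) u a -> is_derive x (1 : R) v b ->
  is_derive x (1 : R) (fun y => u y * v y) (a * v x + u x * b).
Proof.
move=> du dv; apply: (@is_derive_eq _ _ _ (u * v)).
rewrite /GRing.scale /=; ring.
Qed.

Lemma is_derive_sub u v x a b : is_derive x (1 : R) u a -> is_derive x (1 : R) v b ->
  is_derive x (1 : R) (fun y => u y - v y) (a - b).
Proof. by move=> du dv; apply: (@is_derive_eq _ _ _ (u - v)). Qed.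

Lemma is_derive_expM c x :
  is_derive x (1 : R) (fun y => expR (c * y)) (c * expR (c * x)).
Proof.
have h : is_derive x (1 : R) (fun y => c * y) c.
  have := is_derive_mul (is_derive_cst (c : R) x 1) (is_derive_id x (1 : R)).
  by rewrite /= mul0r add0r mulr1.
rewrite mulrC; exact: (@is_derive1_comp _ expR (fun y => c * y)).
Qed.

Lemma nonincreasing_of_derive u du a b : a <= b ->
  (forall x, a <= x <= b -> is_derive x (1 : R) u (du x)) ->
  (forall x, a <= x <= b -> du x <= 0) -> u b <= u a.
Proof.
move=> ab du_u du0.
have cu : {within `[a, b], continuous u}.
  apply: continuous_in_subspaceT => x; rewrite inE /= in_itv /= => xab.
  have [du_x _] := du_u x xab.
  exact/differentiable_continuous/derivable1_diffP.
have di x : x \in `]a, b[ -> is_derive x (1 : R) u (du x).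
  by rewrite in_itv /= => /andP[ax xb]; apply: du_u; rewrite !ltW.
have [x] := MVT_segment ab di cu.
rewrite in_itv /= => xab h; rewrite -subr_le0 h.
by rewrite mulr_le0_ge0 ?du0 ?subr_ge0.
Qed.

Lemma exponential_decay u du c a b : a <= b ->
  (forall x, a <= x <= b -> is_derive x (1 : R) u (du x)) ->
  (forall x, a <= x <= b -> du x <= - c * u x) ->
  u b <= expR (- c * (b - a)) * u a.
Proof.
move=> ab du_u du_le.
have h : expR (c * b) * u b <= expR (c * a) * u a.
  apply: (nonincreasing_of_derive (u := fun x => expR (c * x) * u x)
    (du := fun x => c * expR (c * x) * u x + expR (c * x) * du x) ab).
    by move=> x /du_u h; apply: is_derive_mul h; exact: is_derive_expM.
  move=> x /du_le h /=.
  have -> : c * expR (c * x) * u x + expR (c * x) * du x =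
    expR (c * x) * (c * u x + du x) by ring.
  by rewrite pmulr_rle0 ?expR_gt0 //; lra.
rewrite -(ler_pM2l (expR_gt0 (c * b))) mulrA -expRD.
by have -> : c * b + - c * (b - a) = c * a by ring.
Qed.

(** The forcing decays at a rate [2 c'] which is at most half of [4 c], so it
    dominates in the long run. *)
Lemma forced_decay u du c c' (v0 : R) a b : a <= b -> 0 <= c -> c' <= c -> 0 <= v0 ->
  (forall x, a <= x <= b -> is_derive x (1 : R) u (du x)) ->
  (forall x, a <= x <= b ->
     du x <= - (4 * c) * u x + 4 * c * (v0 * expR (- (2 * c') * x))) ->
  u b <= expR (- (4 * c) * (b - a)) * u a + 2 * v0 * expR (- (2 * c') * b).
Proof.
move=> ab c0 cc' v00 du_u du_le.
set e := 4 * c - 2 * c'.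
have h : expR (4 * c * b) * u b - 2 * v0 * expR (e * b) <=
         expR (4 * c * a) * u a - 2 * v0 * expR (e * a).
  pose w x := expR (4 * c * x) * u x - 2 * v0 * expR (e * x).
  pose dw x := (4 * c * expR (4 * c * x) * u x + expR (4 * c * x) * du x) -
    (0 * expR (e * x) + 2 * v0 * (e * expR (e * x))).
  apply: (nonincreasing_of_derive (u := w) (du := dw) ab) => x xab.
    apply: is_derive_sub; last first.
      by apply: is_derive_mul; exact: is_derive_expM.
    by apply: is_derive_mul; [exact: is_derive_expM | exact: du_u].
  have E : expR (e * x) = expR (4 * c * x) * expR (- (2 * c') * x).
    by rewrite -expRD; congr expR; rewrite /e; ring.
  have -> : dw x = expR (4 * c * x) *
      (4 * c * u x + du x - 2 * v0 * e * expR (- (2 * c') * x)).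
    by rewrite /dw E; ring.
  rewrite pmulr_rle0 ?expR_gt0 //; have := du_le x xab.
  set E1 := expR (- (2 * c') * x).
  have : 0 <= v0 * E1 by rewrite mulr_ge0 ?expR_ge0.
  have : 0 <= (2 * c - 2 * c') * (v0 * E1).
    by rewrite !mulr_ge0 ?expR_ge0 //; lra.
  by rewrite /e; lra.
rewrite -(ler_pM2l (expR_gt0 (4 * c * b))) mulrDr !mulrA -expRD.
have -> : 4 * c * b + - (4 * c) * (b - a) = 4 * c * a by ring.
have E : expR (e * b) = expR (4 * c * b) * expR (- (2 * c') * b).
  by rewrite -expRD; congr expR; rewrite /e; ring.
have : 0 <= v0 * expR (e * a) by rewrite mulr_ge0 ?expR_ge0.
by rewrite E in h; lra.
Qed.

(** Nash's argument: the negative power [y = u^(-alpha)] satisfies the linear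
    inequality [y' >= alpha / tau - alpha y / T], so it is bounded below at time
    [T] even if [u 0] is arbitrarily large. *)
Lemma nash_decay u du (alpha tau T : R) : 0 < alpha -> 0 < tau -> 0 < T ->
  (forall x, 0 <= x <= T -> is_derive x (1 : R) u (du x)) ->
  (forall x, 0 <= x <= T -> 0 < u x) ->
  (forall x, 0 <= x <= T -> du x <= - (u x * expR (alpha * ln (u x)) / tau) + u x / T) ->
  T / tau * (1 - expR (- alpha)) <= expR (- alpha * ln (u T)).
Proof.
move=> al0 tau0 T0 du_u u0 du_le.
have T00 : 0 <= (0 : R) <= T by apply/andP; split=> //; exact: ltW.
have TT : 0 <= T <= T by apply/andP; split=> //; exact: ltW.
pose y x := expR (- alpha * ln (u x)).
pose z x := expR (alpha / T * x) * (T / tau - y x).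
have dy x : 0 <= x <= T -> is_derive x (1 : R) y (- alpha * (du x / u x) * y x).
  move=> xT; rewrite mulrC.
  have hl : is_derive x (1 : R) (fun t => ln (u t)) ((u x)^-1 * du x).
    apply: (@is_derive1_comp _ (@ln R) u); last exact: du_u.
    by apply: is_derive1_ln; exact: u0.
  have hm : is_derive x (1 : R) (fun t => - alpha * ln (u t)) (- alpha * (du x / u x)).
    have := is_derive_mul (is_derive_cst (- alpha : R) x 1) hl.
    by rewrite mul0r add0r [_ / _]mulrC.
  exact: (@is_derive1_comp _ expR (fun t => - alpha * ln (u t))).
pose dz x := (alpha / T * expR (alpha / T * x)) * (T / tau - y x) +
    expR (alpha / T * x) * (0 - (- alpha * (du x / u x) * y x)).
have h : z T <= z 0.
  apply: (nonincreasing_of_derive (u := z) (du := dz) (ltW T0)) => x xT.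
    apply: is_derive_mul; first exact: is_derive_expM.
    by apply: is_derive_sub; exact: dy.
  have ux := u0 x xT; have y0 : 0 < y x := expR_gt0 _.
  have -> : dz x = expR (alpha / T * x) * alpha *
      (tau^-1 - y x / T + y x * (du x / u x)).
    by rewrite /dz; field; rewrite !gt_eqF.
  rewrite pmulr_rle0 ?mulr_gt0 ?expR_gt0 //.
  have yE : y x * expR (alpha * ln (u x)) = 1.
    by rewrite /y -expRD mulNr addNr expR0.
  have : du x / u x <= - (expR (alpha * ln (u x)) / tau) + T^-1.
    rewrite ler_pdivrMr //; apply: le_trans (du_le x xT) _.
    by rewrite le_eqVlt; apply/orP; left; apply/eqP; ring.
  move=> /(ler_wpM2l (ltW y0)).
  have -> : y x * (- (expR (alpha * ln (u x)) / tau) + T^-1) =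
      - (y x * expR (alpha * ln (u x)) / tau) + y x / T by ring.
  by rewrite yE; lra.
move: h; rewrite /z mulr0 expR0 mul1r divfK ?gt_eqF //.
have y0 : 0 < y 0 := expR_gt0 _.
have eE : expR (- alpha) * expR alpha = 1 by rewrite -expRD addNr expR0.
move=> h; rewrite -/(y T).
have : expR (- alpha) * (expR alpha * (T / tau - y T)) <= expR (- alpha) * (T / tau).
  rewrite ler_pM2l ?expR_gt0 //; lra.
by rewrite mulrA eE mul1r mulrBr mulr1; lra.
Qed.

(** The left-hand side is the tangent at [m] of the convex power on the right.
    This linear bound passes under expectations. *)
Lemma power_tangent (alpha m x : R) : 0 < alpha -> 0 < m -> 0 <= x ->
  (1 + alpha) * expR (alpha * ln m) * x - alpha * (m * expR (alpha * ln m)) <=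
  x `^ (1 + alpha).
Proof.
move=> al0 m0 x0; have p0 : 0 < 1 + alpha by lra.
have xm0 : 0 <= x / m by rewrite divr_ge0 // ltW.
have q0 : 0 < (1 + alpha) / alpha by rewrite divr_gt0.
have pq : (1 + alpha)^-1 + ((1 + alpha) / alpha)^-1 = 1.
  by rewrite invf_div; field; rewrite !gt_eqF.
have := conjugate_powR xm0 ler01 p0 q0 pq.
rewrite powR1 mulr1 powRM ?invr_ge0 => [h||]; [|exact: x0|exact: ltW].
have mE : m^-1 `^ (1 + alpha) = (m * expR (alpha * ln m))^-1.
  rewrite /powR gt_eqF ?invr_gt0 // lnV ?posrE // mulrN expRN mulrDl mul1r.
  by rewrite expRD lnK.
set E := expR (alpha * ln m) in mE *; have E0 : 0 < E := expR_gt0 _.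
rewrite mE in h.
have mE0 : 0 < m * E by rewrite mulr_gt0.
move: h; rewrite -(ler_pM2l (mulr_gt0 p0 mE0)).
have -> : (1 + alpha) * (m * E) * (x / m) = (1 + alpha) * E * x.
  by field; rewrite gt_eqF.
have -> : (1 + alpha) * (m * E) * (x `^ (1 + alpha) / (m * E) / (1 + alpha) +
   1 / ((1 + alpha) / alpha)) = x `^ (1 + alpha) + alpha * (m * E).
  by field; rewrite !gt_eqF.
lra.
Qed.

End ODE.

(** * Norms of the relative density *)

Section Norms.
Variables (R : realType) (G : wgraph R).
Implicit Types (x y z : G) (psi : G -> R) (eta : simplex G).

Lemma sum_site_ge0 psi : (forall x, 0 <= psi x) -> 0 <= \sum_x site x * psi x.
Proof. by move=> psi0; apply: sumr_ge0 => x _; rewrite mulr_ge0 // ltW ?site_gt0. Qed.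

Lemma pnorm2_sq psi : pnorm 2 psi ^+ 2 = \sum_x site x * psi x ^+ 2.
Proof.
rewrite /pnorm -powR_mulrn ?powR_ge0 // -powRrM mulVf ?pnatr_eq0 // powRr1.
  apply: eq_bigr => x _; rewrite powR_mulrn // real_normK ?num_real //.
by apply: sum_site_ge0 => x; rewrite powR_ge0.
Qed.

Lemma pnorm1E psi : pnorm 1 psi = \sum_x site x * `|psi x|.
Proof.
rewrite /pnorm invr1 powRr1; last by apply: sum_site_ge0 => x; rewrite powR_ge0.
by apply: eq_bigr => x _; rewrite powRr1.
Qed.

(** Jensen's inequality for the probability measure [site], from the tangent to
    the power [q / p] at the mean of [|psi|^p]. *)
Lemma pnorm_le (p q : R) psi : 0 < p -> p < q -> pnorm p psi <= pnorm q psi.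
Proof.
move=> p0 pq; have q0 : 0 < q by apply: lt_trans pq.
set s := \sum_x site x * `|psi x| `^ p.
set S := \sum_x site x * `|psi x| `^ q.
have s0 : 0 <= s by apply: sum_site_ge0 => x; rewrite powR_ge0.
have S0 : 0 <= S by apply: sum_site_ge0 => x; rewrite powR_ge0.
suff sS : s `^ (q / p) <= S.
  rewrite /pnorm -/s -/S.
  have -> : s `^ p^-1 = (s `^ (q / p)) `^ q^-1.
    by rewrite -powRrM; congr (_ `^ _); field; rewrite !gt_eqF.
  by rewrite ge0_ler_powR ?nnegrE ?powR_ge0 // invr_ge0 ltW.
move: s0; rewrite le_eqVlt => /predU1P[<-|s0].
  by rewrite powR0 // mulf_neq0 ?invr_eq0 // gt_eqF.
pose a := q / p - 1.
have a0 : 0 < a by rewrite /a subr_gt0 ltr_pdivlMr // mul1r.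
have pE x : (`|psi x| `^ p) `^ (1 + a) = `|psi x| `^ q.
  by rewrite -powRrM /a; congr (_ `^ _); field; rewrite gt_eqF.
have tangent x := power_tangent a0 s0 (powR_ge0 `|psi x| p).
have -> : s `^ (q / p) = (1 + a) * expR (a * ln s) * s - a * (s * expR (a * ln s)).
  have -> : q / p = 1 + a by rewrite /a; ring.
  rewrite /powR gt_eqF // mulrDl mul1r expRD lnK ?posrE //; ring.
apply: le_trans (_ : \sum_x site x * ((1 + a) * expR (a * ln s) * `|psi x| `^ p -
   a * (s * expR (a * ln s))) <= _); last first.
  by apply: ler_sum => x _; rewrite ler_pM2l ?site_gt0 // -pE.
rewrite le_eqVlt; apply/orP; left; apply/eqP.
transitivity ((1 + a) * expR (a * ln s) * s -
  (\sum_(x : G) site x) * (a * (s * expR (a * ln s)))).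
  by rewrite site_sum mul1r.
rewrite mulr_sumr mulr_suml -sumrB; apply: eq_bigr => x _; ring.
Qed.

Lemma pnorm_le2 (p : R) psi : 1 <= p -> p <= 2 -> pnorm p psi <= pnorm 2 psi.
Proof.
move=> p1; rewrite le_eqVlt => /predU1P[->//|]; apply: pnorm_le.
exact: lt_le_trans p1.
Qed.

Lemma pnorm1_le (p : R) psi : 1 <= p -> pnorm 1 psi <= pnorm p psi.
Proof. by rewrite le_eqVlt => /predU1P[->//|]; apply: pnorm_le. Qed.

Definition centered eta : G -> R := fun x => rel_density eta x - 1.

Definition variance_density eta : R := sq_density eta - 1.

Lemma sum_centered_sq eta :
  \sum_x site x * centered eta x ^+ 2 = variance_density eta.
Proof.
have -> : variance_density eta =
    sq_density eta - 2 * (\sum_x eta x) + \sum_(x : G) site x.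
  by rewrite mass_sum site_sum /variance_density; ring.
rewrite mulr_sumr -sumrB -big_split; apply: eq_bigr => x _ /=.
by rewrite /centered /rel_density; field; rewrite gt_eqF ?site_gt0.
Qed.

Lemma variance_density_ge0 eta : 0 <= variance_density eta.
Proof. by rewrite -sum_centered_sq; apply: sum_site_ge0 => x; rewrite sqr_ge0. Qed.

Lemma sq_density_ge1 eta : 1 <= sq_density eta.
Proof. by rewrite -subr_ge0 variance_density_ge0. Qed.

Lemma observable_variance_density : observable variance_density.
Proof.
apply: observableD; [exact: observable_sq_density | exact: observable_cst].
Qed.

(** A bound of the norm by an affine function of its square, so that a mean of
    the square controls a mean of the norm; it is sharp at norm [s]. *)
Lemma pnorm2_centered_le (s : R) eta : 0 < s ->
  pnorm 2 (centered eta) <= (2 * s)^-1 * variance_density eta + s / 2.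
Proof.
move=> s0; rewrite -sum_centered_sq -pnorm2_sq.
set m := pnorm 2 _.
rewrite -subr_ge0 (_ : _ - m = (2 * s)^-1 * (m - s) ^+ 2); last first.
  by field; rewrite gt_eqF.
by rewrite mulr_ge0 ?sqr_ge0 // invr_ge0 mulr_ge0 // ltW.
Qed.

Lemma observable_pnorm (p : R) : 1 <= p -> p <= 2 ->
  observable (fun eta => pnorm p (centered eta)).
Proof.
move=> p1 p2; split.
  apply: (measurableT_comp (measurable_powR _)).
  apply: measurable_sum => x; apply: measurable_funM => //.
  apply: (measurableT_comp (measurable_powR _)); apply: measurableT_comp => //.
  apply: measurable_funB => //; apply: measurable_funM => //.
  exact: measurable_coord.
have [_ [M VM]] := observable_variance_density.
exists ((2 * 1)^-1 * M + 1 / 2) => eta; rewrite ger0_norm ?powR_ge0 //.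
apply: le_trans (pnorm_le2 _ p1 p2) _.
apply: le_trans (pnorm2_centered_le _ ltr01) _.
by rewrite lerD2r ler_pM2l // (le_trans _ (VM eta)) // ler_norm.
Qed.

End Norms.

(** * Smoothing by the Nash inequality *)

Section OneGraph.
Variables (R : realType) (G : wgraph R).
Variable eta_ : forall eta : simplex G, averaging_process eta.
Variables (phi : 'I_#|G| -> G -> R) (lam : 'I_#|G| -> R).
Hypothesis phi_ortho : forall i j, inner (phi i) (phi j) = (i == j)%:R.
Hypothesis phi_eigen : forall i x, - bin1_gen (phi i) x = lam i * phi i x.
Hypothesis parseval :
  forall f g, inner f g = \sum_i inner f (phi i) * inner g (phi i).
Implicit Types (x y z : G) (eta : simplex G) (t : R).

Local Notation S := (@avg_semigroup R G).

Lemma semigroup_sum (I : finType) (P : pred I) (F : I -> simplex G -> R) t eta :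
  0 <= t -> (forall i, observable (F i)) ->
  S t (fun eta => \sum_(i | P i) F i eta) eta = \sum_(i | P i) S t (F i) eta.
Proof.
move=> t0 oF; elim: (index_enum I) => [|i r IH].
  rewrite big_nil; under eq_fun do rewrite big_nil.
  exact: semigroup_cst.
rewrite big_cons; under eq_fun do rewrite big_cons.
case: (P i) => //; rewrite (semigroupD (eta_ eta)) ?IH //.
exact: observable_sum.
Qed.

(** Jensen's inequality, from the tangent to the square at the mean. *)
Lemma semigroup_sq_ge (f : simplex G -> R) t eta : 0 <= t -> observable f ->
  S t f eta ^+ 2 <= S t (fun eta => f eta ^+ 2) eta.
Proof.
move=> t0 of_; set m := S t f eta.
have o1 : observable (fun eta => 2 * m * f eta + - m ^+ 2) by exact: observable_affine.
have o2 : observable (fun eta => f eta ^+ 2).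
  by under eq_fun do rewrite expr2; exact: observableM.
have := semigroup_le (eta_ eta) t0 o1 o2.
rewrite (semigroup_affine (eta_ eta)) // -/m => h.
apply: le_trans (h _); first by rewrite le_eqVlt; apply/orP; left; apply/eqP; ring.
by move=> eta'; rewrite -subr_ge0 (_ : _ - _ = (f eta' - m) ^+ 2) ?sqr_ge0 //; ring.
Qed.

Lemma semigroup_derive_le (f h : simplex G -> R) t eta : 0 <= t ->
  observable f -> observable h -> (forall eta, avg_gen f eta <= h eta) ->
  S t (avg_gen f) eta <= S t h eta.
Proof.
by move=> t0 of_ oh fh; apply: (semigroup_le (eta_ eta)) => //; exact: observable_avg_gen.
Qed.

Lemma semigroup_sq_density_ge1 t eta : 0 <= t -> 1 <= S t (@sq_density R G) eta.
Proof.
move=> t0; rewrite -[leLHS](@semigroup_cst _ _ eta 1 t).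
apply: (semigroup_le (eta_ eta)) => //; [exact: observable_cst|exact: observable_sq_density|].
exact: sq_density_ge1.
Qed.

Section Nash.
Variables (d tN T : R).
Hypotheses (d0 : 0 < d) (tN0 : 0 < tN) (T0 : 0 < T) (nashG : nash G d tN T).
Let alpha : R := 2 / d.

(** Densities have [l1] norm 1, so the Nash inequality bounds their energy from
    below by a power of [sq_density] alone. *)
Lemma nash_density eta :
  sq_density eta `^ (1 + alpha) / tN - sq_density eta / T <=
  bin1_dirichlet (rel_density eta).
Proof.
have X2 : pnorm 2 (rel_density eta) ^+ 2 = sq_density eta.
  rewrite pnorm2_sq; apply: eq_bigr => x _; rewrite /rel_density.
  by field; rewrite gt_eqF ?site_gt0.
have X1 : pnorm 1 (rel_density eta) = 1.
  rewrite pnorm1E -(mass_sum eta); apply: eq_bigr => x _.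
  rewrite ger0_norm /rel_density; first by field; rewrite gt_eqF ?site_gt0.
  by rewrite divr_ge0 ?mass_ge0 // ltW ?site_gt0.
have := nashG (rel_density eta).
rewrite X1 powR1 mulr1 X2 powRrM powR_mulrn ?powR_ge0 // X2.
rewrite -/alpha mulrC -ler_pdivrMr // [T^-1 * _]mulrC; lra.
Qed.

(** The right-hand side is a negative power of the mean [sq_density] at time
    [T], so this is an upper bound for that mean which does not depend on the
    initial measure. *)
Lemma nash_smoothing eta :
  T / tN * (1 - expR (- alpha)) <= expR (- alpha * ln (S T (@sq_density R G) eta)).
Proof.
have al0 : 0 < alpha by rewrite divr_gt0.
have oX := observable_sq_density G.
have [_ bX] := oX.
apply: (nash_decay al0 tN0 T0
  (u := fun t => S t (@sq_density R G) eta)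
  (du := fun t => S t (avg_gen (@sq_density R G)) eta)) => t /andP[t0 tT].
- exact: is_derive_semigroup.
- exact: lt_le_trans ltr01 (semigroup_sq_density_ge1 _ t0).
set m := S t (@sq_density R G) eta; set E := expR (alpha * ln m).
have m0 : 0 < m := lt_le_trans ltr01 (semigroup_sq_density_ge1 eta t0).
(* The tangent at the current mean [m] makes the inequality affine in
   [sq_density], so that it can be averaged without loss. *)
pose a := - ((1 + alpha) * E / tN) + T^-1; pose b := alpha * (m * E) / tN.
have oh : observable (fun eta => a * sq_density eta + b) by exact: observable_affine.
apply: le_trans (semigroup_derive_le eta t0 oX oh _) _.
  move=> eta'; rewrite avg_gen_sq_density.
  have := power_tangent al0 m0 (le_trans ler01 (sq_density_ge1 eta')).
  have iN : 0 < tN^-1 by rewrite invr_gt0.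
  move=> /(ler_wpM2r (ltW iN)); have := nash_density eta'.
  rewrite /a /b -/E; lra.
rewrite (semigroup_affine (eta_ eta)) // -/m /a /b; lra.
Qed.

End Nash.

(** * Low modes and the sharp decay *)

Section LowModes.
Hypotheses (gap_gt0 : 0 < gap G) (gap_le : forall i, 0 < lam i -> gap G <= lam i).

(** The threshold is twice the target rate [2 * gap], because half of the
    dissipation will pay for the noise in [avg_gen_V]. *)
Let low : pred 'I_#|G| := fun i => (0 < lam i) && (lam i < 4 * gap G).

Definition low_energy eta : R := \sum_(i | low i) pairing (phi i) eta ^+ 2.

Lemma sq_density_modes eta : sq_density eta = \sum_i pairing (phi i) eta ^+ 2.
Proof. by rewrite sq_densityE parseval; apply: eq_bigr => i _; rewrite pairingE. Qed.

Lemma low_energy_le eta : low_energy eta <= sq_density eta.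
Proof.
rewrite sq_density_modes [leRHS](bigID low) /= lerDl.
by apply: sumr_ge0 => i _; rewrite sqr_ge0.
Qed.

Lemma observable_low_energy : observable low_energy.
Proof.
apply: observable_sum => i; under eq_fun do rewrite expr2.
by apply: observableM; exact: observable_pairing.
Qed.

Lemma avg_gen_mode i eta :
  avg_gen (pairing (phi i)) eta = - lam i * pairing (phi i) eta.
Proof.
rewrite avg_gen_pairing mulr_sumr; apply: eq_bigr => z _.
by rewrite -[bin1_gen _ _]opprK phi_eigen; ring.
Qed.

(** The high modes have energy at least [4 * gap] times their squared norm.  The
    zero modes are constant, and their share of [sq_density] is at most the
    squared norm of the constant 1, which [variance_density] subtracts. *)
Lemma high_modes_dissipation eta :
  4 * gap G * (variance_density eta - low_energy eta) <=
  bin1_dirichlet (rel_density eta).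
Proof.
pose zero i := lam i <= 0.
have zero_le1 : \sum_(i | zero i) pairing (phi i) eta ^+ 2 <= 1.
  have one1 : \sum_i inner (fun _ => 1) (phi i) ^+ 2 = 1 :> R.
    transitivity (inner (fun _ : G => 1) (fun _ => 1) : R); first by rewrite parseval.
    by rewrite /inner -[RHS](site_sum G); apply: eq_bigr => x _; rewrite !mulr1.
  rewrite -[leRHS]one1 [leRHS](bigID zero) /=.
  rewrite ler_wpDr //; first by apply: sumr_ge0 => i _; rewrite sqr_ge0.
  apply: ler_sum => i zi; rewrite le_eqVlt; apply/orP; left; apply/eqP.
  congr (_ ^+ 2).
  have [x0 _] := vertex_exists G.
  have cst x : phi i x = phi i x0 by apply: (eigenvalue_const phi_ortho phi_eigen zi).
  transitivity (phi i x0).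
    by rewrite -[RHS]mul1r -(mass_sum eta) mulr_suml; apply: eq_bigr => x _; rewrite cst.
  by rewrite (constant_inner (a := 1) (b := phi i x0)) ?mul1r.
have g4 : 0 <= 4 * gap G by rewrite mulr_ge0 // ltW.
have -> : bin1_dirichlet (rel_density eta) = \sum_i lam i * pairing (phi i) eta ^+ 2.
  rewrite (dirichlet_spectral phi_eigen parseval).
  by apply: eq_bigr => i _; rewrite pairingE.
apply: le_trans (_ : 4 * gap G * (sq_density eta -
   \sum_(i | zero i) pairing (phi i) eta ^+ 2 - low_energy eta) <= _).
  by rewrite ler_wpM2l // /variance_density; lra.
rewrite sq_density_modes /low_energy [\sum_(i | zero i) _]big_mkcond.
rewrite [\sum_(i | low i) _]big_mkcond -!sumrB mulr_sumr.
apply: ler_sum => i _; rewrite /zero /low.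
have p0 := sqr_ge0 (pairing (phi i) eta); set p := _ ^+ 2 in p0 *.
have [l0|l0] /= := leP (lam i) 0.
  by rewrite !subrr mulr0 mulr_ge0 // (eigenvalue_ge0 phi_ortho phi_eigen).
have [l4|l4] := ltP (lam i) (4 * gap G).
  by rewrite subr0 subrr mulr0 mulr_ge0 // ltW.
by rewrite !subr0 ler_wpM2r.
Qed.

Section Smoothed.
Variables (T M0 : R).
Hypotheses (T_ge0 : 0 <= T) (M0_ge0 : 0 <= M0).
Hypothesis smooth : forall eta, S T (@sq_density R G) eta <= M0.

Let M1 : R := expR (8 * gap G * T) * M0.

(** Until time [T] the mean of a low mode is multiplied by at least
    [exp (- 4 gap T)], and its square at time [T] is part of the smoothed
    [sq_density]. *)
Lemma low_energy_bound eta : low_energy eta <= M1.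
Proof.
rewrite /M1 -ler_pdivrMl ?expR_gt0 // -expRN.
apply: le_trans (smooth eta).
have op i : observable (pairing (phi i)) := observable_pairing (phi i).
have op2 i : observable (fun eta => pairing (phi i) eta ^+ 2).
  by under eq_fun do rewrite expr2; exact: observableM.
apply: le_trans (semigroup_le (eta_ eta) T_ge0 observable_low_energy
  (observable_sq_density G) low_energy_le).
rewrite semigroup_sum // mulr_sumr; apply: ler_sum => i /andP[l0 l4].
apply: le_trans (semigroup_sq_ge eta T_ge0 (op i)).
rewrite (semigroup_eigen _ _ (avg_gen_mode i)) exprMn ler_wpM2r ?sqr_ge0 //.
rewrite -expRM_natl ler_expR.
have : lam i * T <= 4 * gap G * T by rewrite ler_wpM2r // ltW.
lra.
Qed.

Definition point_mass x : simplex G.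
Proof.
refine (@Simplex R G (fun z => (z == x)%:R) _ _) => [z|]; first exact: ler0n.
by rewrite (bigD1 x) //= eqxx big1 ?addr0 // => z /negbTE ->.
Defined.

Lemma pairing_point_mass f x : pairing f (point_mass x) = f x.
Proof.
rewrite /pairing (bigD1 x) //= eqxx mul1r big1 ?addr0 // => z /negbTE ->.
by rewrite mul0r.
Qed.

Lemma low_modes_pointwise x : \sum_(i | low i) phi i x ^+ 2 <= M1.
Proof.
have := low_energy_bound (point_mass x).
by rewrite /low_energy; under eq_bigr do rewrite pairing_point_mass.
Qed.

Variable kmax : R.
Hypothesis conduct_le : forall x y, conduct x y <= kmax.

Let eps : R := 4 * M1 * kmax.

(** The noise of an update of [xy] is [conduct x y] times the energy of the edge
    times the squared increment of the low modes along [xy]; the first factor is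
    at most [kmax] and the last at most [4 * M1]. *)
Lemma avg_gen_low_energy eta :
  avg_gen low_energy eta <=
  - (2 * gap G) * low_energy eta + eps * bin1_dirichlet (rel_density eta).
Proof.
rewrite avg_gen_sum.
under eq_bigr do rewrite (avg_gen_pairing_sq _ (phi_eigen _)).
rewrite big_split /= -sum_edges_sum lerD //.
  rewrite mulr_sumr; apply: ler_sum => i /andP[l0 _].
  rewrite ler_wpM2r ?sqr_ge0 //; have := gap_le l0; lra.
rewrite -sum_edgesZ; apply: ler_sum_edges => x y exy.
set r := (rel_density eta x - rel_density eta y) ^+ 2.
have r0 : 0 <= r := sqr_ge0 _.
have w0 := weight_gt0 exy; have k0 := conduct_gt0 x y.
have -> : \sum_(i | low i) weight x y * (conduct x y ^+ 2 * r * (phi i x - phi i y) ^+ 2) =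
  (weight x y * conduct x y * r) *
    (conduct x y * \sum_(i | low i) (phi i x - phi i y) ^+ 2).
  by rewrite !mulr_sumr; apply: eq_bigr => i _; ring.
have -> : eps * (weight x y * (site x * site y / (site x + site y)) * r) =
    (weight x y * conduct x y * r) * eps by rewrite /conduct; ring.
apply: ler_wpM2l; first by apply: mulr_ge0 => //; apply: mulr_ge0; exact: ltW.
rewrite /eps mulrC; apply: ler_pM; last exact: conduct_le.
- by apply: sumr_ge0 => i _; rewrite sqr_ge0.
- exact: ltW.
apply: le_trans (_ : \sum_(i | low i) (2 * phi i x ^+ 2 + 2 * phi i y ^+ 2) <= _).
  apply: ler_sum => i _; rewrite -subr_ge0.
  by rewrite (_ : _ - _ = (phi i x + phi i y) ^+ 2) ?sqr_ge0 //; ring.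
rewrite big_split /= -!mulr_sumr.
have := low_modes_pointwise x; have := low_modes_pointwise y; lra.
Qed.

Let V eta : R := low_energy eta + 2 * eps * variance_density eta.

Let kmax_ge0 : 0 <= kmax.
Proof.
have [x _] := vertex_exists G.
exact: le_trans (ltW (conduct_gt0 x x)) (conduct_le x x).
Qed.

Let M1_ge0 : 0 <= M1.
Proof. by rewrite mulr_ge0 ?expR_ge0. Qed.

Let eps_ge0 : 0 <= eps.
Proof. by rewrite !mulr_ge0. Qed.

Let rate : R := gap G * (1 - 2 * eps).

(** Half of the dissipation of [2 * eps * variance_density] pays for the energy
    fed into the low modes.  The other half makes this term decay at rate
    [2 * gap], up to the low modes. *)
Let avg_gen_V eta : avg_gen V eta <= - (2 * rate) * V eta.
Proof.
have -> : avg_gen V eta = avg_gen low_energy eta +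
    2 * eps * avg_gen (@variance_density R G) eta.
  by rewrite avg_genD avg_genZ.
have -> : avg_gen (@variance_density R G) eta = - bin1_dirichlet (rel_density eta).
  by rewrite avg_genD avg_gen_cst addr0 avg_gen_sq_density.
have h1 := avg_gen_low_energy eta.
have := ler_wpM2l eps_ge0 (high_modes_dissipation eta).
set E := bin1_dirichlet _ in h1 *; set g := low_energy eta in h1 *.
set X := variance_density eta => h2.
have : 0 <= eps ^+ 2 * gap G * X.
  by rewrite !mulr_ge0 ?sqr_ge0 ?variance_density_ge0 // ltW.
rewrite /V /rate -/g -/X; lra.
Qed.

Variable Xmax : R.
Hypothesis sq_density_le : forall eta, sq_density eta <= Xmax.

Let v0 : R := M1 + 2 * eps * Xmax.

Lemma observable_lyapunov : observable V.
Proof.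
apply: observableD; first exact: observable_low_energy.
by apply: observableZ; exact: observable_variance_density.
Qed.

Lemma lyapunov_decay eta t : 0 <= t -> S t V eta <= v0 * expR (- (2 * rate) * t).
Proof.
move=> t0; have oV := observable_lyapunov; have [_ bV] := oV.
have := @exponential_decay R (fun t => S t V eta) (fun t => S t (avg_gen V) eta)
  (2 * rate) 0 t t0.
rewrite semigroup0 subr0 => h.
apply: le_trans (h _ _) _.
- by move=> s _; exact: is_derive_semigroup.
- move=> s /andP[s0 _]; rewrite -(semigroupZ (eta_ eta)) //.
  by apply: semigroup_derive_le => //; exact: observableZ.
rewrite mulrC ler_wpM2r ?expR_ge0 // lerD ?low_energy_bound //.
rewrite ler_wpM2l ?mulr_ge0 // (le_trans _ (sq_density_le eta)) //.
by rewrite /variance_density gerBl.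
Qed.

(** Past time [T] the initial value is bounded by [M0], and the forcing of the
    high modes by the low ones is at most [V]. *)
Theorem variance_decay eta t : T <= t ->
  S t (@variance_density R G) eta <=
  expR (- (4 * gap G) * (t - T)) * M0 + 2 * v0 * expR (- (2 * rate) * t).
Proof.
move=> Tt; have oX := observable_variance_density G; have [_ bX] := oX.
have Xmax_ge0 : 0 <= Xmax.
  by rewrite (le_trans _ (sq_density_le eta)) // (le_trans _ (sq_density_ge1 eta)).
have v00 : 0 <= v0 by rewrite addr_ge0 // !mulr_ge0.
apply: le_trans (forced_decay (u := fun t => S t (@variance_density R G) eta)
  (du := fun t => S t (avg_gen (@variance_density R G)) eta) (c := gap G)
  (c' := rate) (v0 := v0) Tt _ _ v00 _ _) _.
- exact: ltW.
- have : 0 <= gap G * eps by apply: mulr_ge0 => //; exact: ltW.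
  by rewrite /rate; lra.
- by move=> s _; exact: is_derive_semigroup.
- move=> s /andP[Ts sT]; have s0 : 0 <= s := le_trans T_ge0 Ts.
  have oV := observable_lyapunov.
  apply: le_trans (_ : - (4 * gap G) * S s (@variance_density R G) eta +
    4 * gap G * S s V eta <= _); last first.
    by rewrite lerD2l ler_wpM2l ?mulr_ge0 ?lyapunov_decay // ltW.
  rewrite -!(semigroupZ (eta_ eta)) // -(semigroupD (eta_ eta)); try exact: observableZ.
    apply: semigroup_derive_le => //.
      by apply: observableD; exact: observableZ.
    move=> eta'; rewrite /variance_density avg_genD avg_gen_cst addr0 avg_gen_sq_density.
    have := high_modes_dissipation eta'.
    have : 0 <= gap G * (2 * eps * variance_density eta').
      by rewrite !mulr_ge0 ?variance_density_ge0 // ltW.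
    rewrite /V /variance_density; lra.
  exact: s0.
rewrite lerD2r ler_wpM2l ?expR_ge0 // (le_trans _ (smooth eta)) //.
apply: (semigroup_le (eta_ eta)) => //; first exact: observable_sq_density.
by move=> eta'; rewrite /variance_density gerBl.
Qed.

End Smoothed.
End LowModes.
End OneGraph.

(** * The worst distance at a fixed time *)

Section Distance.
Variables (R : realType) (G : wgraph R).
Variable eta_ : forall eta : simplex G, averaging_process eta.
Implicit Types (x y z : G) (eta : simplex G) (t p : R).

Local Notation S := (@avg_semigroup R G).

Lemma expectation_pnorm eta p t : 1 <= p -> p <= 2 -> 0 <= t ->
  ('E_(avg_prob (eta_ eta))[fun w =>
      pnorm p (fun x => rel_density (avg_state (eta_ eta) t w) x - 1)%R] =
   (S t (fun eta => pnorm p (centered eta)) eta)%:E)%E.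
Proof.
move=> p1 p2 t0; rewrite unlock.
exact: (semigroup_expectation (eta_ eta) t0 (observable_pnorm G p1 p2)).
Qed.

Lemma worst_distance_le p t (s : R) : 1 <= p -> p <= 2 -> 0 <= t -> 0 < s ->
  (forall eta, S t (@variance_density R G) eta <= s ^+ 2) ->
  (worst_distance eta_ p t <= s%:E)%E.
Proof.
move=> p1 p2 t0 s0 hs; apply: ge_ereal_sup => _ [eta _ <-].
rewrite expectation_pnorm // lee_fin.
have oV := observable_variance_density G.
have oh : observable (fun eta => (2 * s)^-1 * variance_density eta + s / 2).
  exact: observable_affine.
apply: le_trans (semigroup_le (eta_ eta) t0 (observable_pnorm G p1 p2) oh _) _.
  by move=> eta'; apply: le_trans (pnorm_le2 _ p1 p2) _; exact: pnorm2_centered_le.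
rewrite (semigroup_affine (eta_ eta)) //.
apply: le_trans (_ : (2 * s)^-1 * s ^+ 2 + s / 2 <= _).
  by rewrite lerD2r ler_wpM2l ?hs // invr_ge0 mulr_ge0 // ltW.
by rewrite le_eqVlt; apply/orP; left; apply/eqP; field; rewrite gt_eqF.
Qed.

(** The process starts from a point mass where the gap eigenfunction has maximal
    modulus; the normalised eigenfunction [f] is then bounded by 1, and its
    pairing with the process is at most the [l1] distance. *)
Lemma worst_distance_ge p t : (1 < #|G|)%N -> 1 <= p -> p <= 2 -> 0 <= t ->
  ((expR (- gap G * t))%:E <= worst_distance eta_ p t)%E.
Proof.
move=> cardG p1 p2 t0.
have [phi [lam [phi_ortho phi_eigen parseval]]] := eigenbasis G.
have [i li [gap_gt0 _]] := gap_attained phi_ortho phi_eigen parseval cardG.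
have [y0 _] := vertex_exists G.
pose x0 := [arg max_(x > y0) `|phi i x|]%O.
have xmax x : `|phi i x| <= `|phi i x0|.
  by rewrite /x0; case: arg_maxP => // z _; apply.
have x00 : phi i x0 != 0.
  apply/eqP => h; have := phi_ortho i i; rewrite eqxx.
  rewrite (constant_inner (a := 0) (b := 0)) ?mul0r => [/eqP|x|x].
  - by rewrite eq_sym oner_eq0.
  - by apply/eqP; rewrite -normr_le0 (le_trans (xmax x)) // h normr0.
  - by apply/eqP; rewrite -normr_le0 (le_trans (xmax x)) // h normr0.
pose f x := phi i x / phi i x0.
have f_eigen x : bin1_gen f x = - gap G * f x.
  transitivity (bin1_gen (phi i) x / phi i x0); last first.
    by rewrite -[bin1_gen _ _]opprK phi_eigen li /f; ring.
  by rewrite /bin1_gen mulr_suml; apply: eq_bigr => y _; rewrite /f; ring.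
have f_mean : \sum_x site x * f x = 0.
  have : inner (fun _ : G => 1) (bin1_gen f) = 0.
    rewrite inner_gen /sum_edges big1 ?mulr0 ?oppr0 // => x _.
    by rewrite big1 // => y _; rewrite subrr mulr0 mul0r.
  have -> : inner (fun _ : G => 1) (bin1_gen f) = - gap G * \sum_x site x * f x.
    by rewrite /inner mulr_sumr; apply: eq_bigr => x _; rewrite f_eigen; ring.
  by move/eqP; rewrite mulf_eq0 oppr_eq0 gt_eqF //= => /eqP.
have f_le1 x : `|f x| <= 1.
  by rewrite /f normrM normfV ler_pdivrMr ?normr_gt0 // mul1r.
have lower eta : pairing f eta <= pnorm p (centered eta).
  apply: le_trans (pnorm1_le _ p1); rewrite pnorm1E.
  have -> : pairing f eta = \sum_x site x * (centered eta x * f x).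
    rewrite pairingE -[LHS]subr0 -[X in _ - X]f_mean -sumrB.
    by apply: eq_bigr => x _; rewrite /centered; ring.
  apply: ler_sum => x _; rewrite ler_pM2l ?site_gt0 //.
  by rewrite (le_trans (ler_norm _)) // normrM ler_piMr.
have pair_eigen eta : avg_gen (pairing f) eta = - gap G * pairing f eta.
  rewrite avg_gen_pairing mulr_sumr; apply: eq_bigr => x _.
  by rewrite f_eigen; ring.
apply: le_ereal_sup_tmp; exists (S t (fun eta => pnorm p (centered eta)) (point_mass x0))%:E.
  by exists (point_mass x0) => //; rewrite expectation_pnorm.
rewrite lee_fin; apply: le_trans (semigroup_le (eta_ _) t0 (observable_pairing f)
  (observable_pnorm G p1 p2) lower).
by rewrite (semigroup_eigen _ _ pair_eigen) pairing_point_mass /f divff // mulr1.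
Qed.

End Distance.

(** * Constants that are uniform over the graphs *)

Lemma elliptic_sites (R : realType) (G : wgraph R) (c : R) :
  max_site G / min_site G <= c -> forall x y : G, site x <= c * site y.
Proof.
move=> Gc x y.
have m0 : 0 < min_site G.
  by apply/bigmin_gtP; split=> [|z _]; [exact: ltr01 | exact: site_gt0].
have mx : site x <= max_site G by exact: le_bigmax.
have my : min_site G <= site y by exact: bigmin_le.
have M0 : 0 < max_site G := lt_le_trans (site_gt0 x) mx.
have c0 : 0 <= c by apply: le_trans Gc; rewrite ltW // divr_gt0.
apply: le_trans mx _; move: Gc; rewrite ler_pdivrMr // => /le_trans; apply.
by rewrite ler_wpM2l.
Qed.

Section Elliptic.
Variables (R : realType) (G : wgraph R) (c : R).
Hypothesis ell : forall x y : G, site x <= c * site y.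
Implicit Types (x y : G).

Lemma elliptic_site_le x : site x <= c / #|G|%:R.
Proof.
have n0 : (0 < #|G|)%N by apply/card_gt0P; exists x.
rewrite ler_pdivlMr ?ltr0n // mulr_natr -sumr_const.
apply: le_trans (_ : \sum_(y : G) c * site y <= _); first exact: ler_sum.
by rewrite -mulr_sumr site_sum mulr1.
Qed.

Lemma elliptic_site_ge x : (site x)^-1 <= c * #|G|%:R.
Proof.
rewrite -(ler_pM2l (site_gt0 x)) divff ?gt_eqF ?site_gt0 //.
apply: le_trans (_ : \sum_(y : G) site y <= _); first by rewrite site_sum.
rewrite mulrA [site x * c]mulrC mulr_natr -sumr_const.
by apply: ler_sum => y _; apply: ell.
Qed.

Lemma elliptic_conduct_le x y : conduct x y <= c / #|G|%:R.
Proof.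
apply: le_trans (elliptic_site_le x).
rewrite /conduct ler_pdivrMr ?siteD_gt0 // mulrDr lerDr.
by rewrite mulr_ge0 // ltW ?site_gt0.
Qed.

Lemma elliptic_sq_density_le (eta : simplex G) : sq_density eta <= c * #|G|%:R.
Proof.
apply: le_trans (_ : \sum_x eta x * (c * #|G|%:R) <= _); last first.
  by rewrite -mulr_suml mass_sum mul1r.
apply: ler_sum => x _.
rewrite expr2 -mulrA ler_wpM2l ?mass_ge0 //.
apply: le_trans (elliptic_site_ge x).
by rewrite ler_piMl ?mass_le1 // invr_ge0 ltW ?site_gt0.
Qed.

End Elliptic.

(** The constants [A] and [E] depend on the graph only through [D], [K], [a] and
    [c].  The term [E / #|G|] is the loss of rate due to the averaging noise. *)
Theorem uniform_variance_decay (R : realType) (D K a c : R) :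
  0 < D -> 0 < K -> 1 <= c ->
  exists A E : R, [/\ 0 < A, 0 < E & forall (G : wgraph R)
    (eta_ : forall eta : simplex G, averaging_process eta) (d tN T : R),
    [/\ (1 < #|G|)%N, 0 < d & d <= D] ->
    [/\ 0 < tN, 0 < T, tN <= K * T & gap G * T <= a] ->
    nash G d tN T -> (forall x y : G, site x <= c * site y) ->
    forall (eta : simplex G) (t : R), T <= t ->
    avg_semigroup t (@variance_density R G) eta <=
    A * (expR (- 4 * (gap G * t)) +
         expR (- 2 * (gap G * t) + E / #|G|%:R * (gap G * t)))].
Proof.
move=> D0 K0 c1; have c0 : 0 < c := lt_le_trans ltr01 c1.
(* [M0] bounds the smoothed density, [M1] the low modes and [W] the initial
   value of the Lyapunov function, where [W] uses [eps <= 4 * M1 * c / #|G|] and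
   [sq_density <= c * #|G|]. *)
pose L := `|ln (K^-1 * (1 - expR (- (2 / D))))|.
pose M0 := expR (L * (D / 2)).
pose M1 := expR (8 * a) * M0.
pose W := M1 + 8 * M1 * c ^+ 2.
have M0_gt0 : 0 < M0 := expR_gt0 _.
have M1_gt0 : 0 < M1 by rewrite mulr_gt0 ?expR_gt0.
have W_gt0 : 0 < W.
  apply: addr_gt0 => //; apply: mulr_gt0; last exact: exprn_gt0.
  exact: mulr_gt0.
exists (expR (4 * a) * M0 + 2 * W), (16 * M1 * c); split.
- apply: addr_gt0; apply: mulr_gt0 => //; exact: expR_gt0.
- by apply: mulr_gt0 => //; exact: mulr_gt0.
move=> G eta_ d tN T [cardG d0 dD] [tN0 T0 tNT gapT] nashG ell eta t Tt.
have n0 : 0 < #|G|%:R :> R by rewrite ltr0n ltnW.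
have [phi [lam [phi_ortho phi_eigen parseval]]] := eigenbasis G.
have [_ _ [gap_gt0 gap_le]] := gap_attained phi_ortho phi_eigen parseval cardG.
have smooth eta' : avg_semigroup T (@sq_density R G) eta' <= M0.
  have := nash_smoothing eta_ d0 tN0 T0 nashG eta'.
  have F1 := semigroup_sq_density_ge1 eta_ eta' (ltW T0).
  set F := avg_semigroup T _ eta' in F1 *; set al := 2 / d => h.
  have F0 : 0 < F := lt_le_trans ltr01 F1.
  have al_ge : 2 / D <= al by rewrite ler_pM2l // lef_pV2.
  have al0 : 0 < al by rewrite divr_gt0.
  have q0 : 0 < 1 - expR (- (2 / D)).
    by rewrite subr_gt0 expR_lt1 oppr_lt0 divr_gt0.
  have h2 : K^-1 * (1 - expR (- (2 / D))) <= expR (- al * ln F).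
    apply: le_trans h; apply: ler_pM.
    - by rewrite invr_ge0 ltW.
    - exact: ltW.
    - by rewrite ler_pdivlMr // mulrC ler_pdivrMr // mulrC.
    - by rewrite lerD2l lerN2 ler_expR lerN2.
  have h3 : al * ln F <= L.
    have := h2; rewrite -ler_ln ?posrE ?mulr_gt0 ?invr_gt0 ?expR_gt0 // expRK => h4.
    have := ler_norm (- ln (K^-1 * (1 - expR (- (2 / D))))).
    by rewrite normrN -/L; lra.
  rewrite -[F]lnK ?posrE // /M0 ler_expR.
  have lnF0 : 0 <= ln F by rewrite ln_ge0.
  have : 2 / D * ln F <= L by apply: le_trans h3; rewrite ler_wpM2r.
  have D20 : 0 < D / 2 by rewrite divr_gt0.
  rewrite -(ler_pM2r D20) => h5; apply: le_trans h5.
  by rewrite le_eqVlt; apply/orP; left; apply/eqP; field; rewrite gt_eqF.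
have := variance_decay eta_ phi_ortho phi_eigen parseval gap_gt0 gap_le (ltW T0)
  (ltW M0_gt0) smooth (elliptic_conduct_le ell) (elliptic_sq_density_le ell) eta Tt.
set M1' := expR (8 * gap G * T) * M0; set n := #|G|%:R in n0 *.
have M1'_le : M1' <= M1.
  by rewrite ler_wpM2r ?(ltW M0_gt0) // ler_expR -mulrA ler_pM2l.
have M1'_gt0 : 0 < M1' by rewrite mulr_gt0 ?expR_gt0.
have t0 : 0 <= t by rewrite (le_trans _ Tt) // ltW.
have gt0 : 0 <= gap G * t by rewrite mulr_ge0 // ltW.
move=> h; apply: le_trans h _.
rewrite [leRHS]mulrDr; apply: lerD.
  have -> : - (4 * gap G) * (t - T) = 4 * (gap G * T) + - 4 * (gap G * t) by ring.
  rewrite expRD mulrAC ler_wpM2r ?expR_ge0 //.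
  apply: le_trans (_ : expR (4 * a) * M0 <= _).
    by rewrite ler_wpM2r ?(ltW M0_gt0) // ler_expR ler_pM2l.
  by rewrite lerDl mulr_ge0 // ltW.
apply: ler_pM.
- have cn0 : 0 <= c / n by rewrite divr_ge0 // ltW.
  have cn1 : 0 <= c * n by rewrite mulr_ge0 // ltW.
  apply: mulr_ge0 => //; apply: addr_ge0; first exact: ltW.
  apply: mulr_ge0 => //; apply: mulr_ge0 => //.
  by apply: mulr_ge0 => //; apply: mulr_ge0 => //; exact: ltW.
- exact: expR_ge0.
- apply: le_trans (_ : 2 * W <= _).
    rewrite ler_pM2l // /W.
    have -> : M1' + 2 * (4 * M1' * (c / n)) * (c * n) = M1' * (1 + 8 * c ^+ 2).
      by field; rewrite gt_eqF.
    have -> : M1 + 8 * M1 * c ^+ 2 = M1 * (1 + 8 * c ^+ 2) by ring.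
    by rewrite ler_wpM2r // addr_ge0 // mulr_ge0 // sqr_ge0.
  by rewrite lerDr mulr_ge0 ?expR_ge0 // ltW.
rewrite ler_expR.
have : M1' * (c / n * (gap G * t)) <= M1 * (c / n * (gap G * t)).
  by rewrite ler_wpM2r // mulr_ge0 // divr_ge0 // ltW.
lra.
Qed.

(** * The cutoff window *)

Section Limsup.
Variable R : realType.
Local Open Scope ereal_scope.
Implicit Types (u : (\bar R)^nat) (l : \bar R).

Lemma limn_esup_le u l : (\forall n \near \oo, u n <= l) -> limn_esup u <= l.
Proof.
move=> ul; apply: ge_ereal_inf; exists (ereal_sup (u @` [set n | u n <= l])).
  by exists [set n | u n <= l].
by apply: ge_ereal_sup => _ [n /= unl <-].
Qed.

Lemma le_limn_einf u l : (\forall n \near \oo, l <= u n) -> l <= limn_einf u.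
Proof.
move=> ul; rewrite /limn_einf leeNr; apply: limn_esup_le.
by apply: filterS ul => n; rewrite leeN2.
Qed.

Lemma near_lt_limn_esup u l : limn_esup u < l -> \forall n \near \oo, u n < l.
Proof.
move=> /ereal_inf_lt[_ [V Voo <-]] Vl; apply: filterS Voo => n Vn.
by apply: le_lt_trans Vl; apply: ereal_sup_ubound; exists n.
Qed.

End Limsup.

Lemma ln_le_sqrt (R : realType) (x : R) : 0 < x -> ln x <= 2 * Num.sqrt x.
Proof.
move=> x0; have s0 : 0 < Num.sqrt x by rewrite sqrtr_gt0.
have -> : ln x = 2 * ln (Num.sqrt x).
  by rewrite -{1}(sqr_sqrtr (ltW x0)) lnXn // mulr_natl.
rewrite ler_pM2l //.
have : ln (1 + (Num.sqrt x - 1)) <= Num.sqrt x - 1.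
  by apply: le_ln1Dx; rewrite ltrBrDl subrr.
rewrite addrC subrK; lra.
Qed.

Theorem theorem2p9 (R : realType) (G : nat -> wgraph R)
  (card_G : forall n, (2 <= n)%N -> #|G n| = n)
  (fd_G : finite_dimensional G) (ell_G : uniformly_elliptic G)
  (k : nat -> R) (k_infty : k n @[n --> \oo] --> +oo)
  (cvol : R) (cvol_ge0 : 0 <= cvol)
  (k_vol : (limn_esup (fun n => (k n / n%:R ^+ 2)%:E) <= cvol%:E)%E)
  (eta_ : forall n (eta : simplex (G n)), averaging_process eta)
  (delta : R) (delta_gt0 : 0 < delta) (delta_lt1 : delta < 1) :
  exists2 C : R, 0 < C & forall p : R, 1 <= p -> p <= 2 ->
    (limn_esup (fun n => (Num.sqrt (k n))%:E *
       worst_distance (eta_ n) p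
         (trel (G n) / 2 * ln (k n) + C * trel (G n))) <= delta%:E)%E /\
    ((delta^-1)%:E <= limn_einf (fun n => (Num.sqrt (k n))%:E *
       worst_distance (eta_ n) p
         (trel (G n) / 2 * ln (k n) - C * trel (G n))))%E.
Proof.
have [d [tN [T [nashG dO tNO TTheta]]]] := fd_G.
have [c c1 ell] := ell_G.
have /eqO_exP[D D0 d_near] := dO.
have /eqO_exP[K1 K10 tN_near] := tNO.
have /eqO_exP[K2 K20 T_near] : T =O_\oo tN.
  by move: TTheta; rewrite eqThetaE bigThetaE => -[].
have /eqO_exP[K K0 tN_near'] : tN =O_\oo T.
  by move: TTheta; rewrite Theta_sym eqThetaE bigThetaE => -[].
pose a := K1 * K2; have a0 : 0 < a by rewrite mulr_gt0.
have [A [E [A0 E0 decay]]] := uniform_variance_decay a D0 K0 c1.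
pose Z := A * (1 + expR 1).
have Z0 : 0 < Z by rewrite mulr_gt0 // addr_gt0 // expR_gt0.
(* The first term serves the upper bound, the second the lower bound, and the
   third places [t+] after the smoothing time. *)
pose C := `|ln (Z / delta ^+ 2)| + `|ln delta| + a + 1.
have C0 : 0 < C by rewrite /C !ltr_wpDl // addr_ge0 // ltW.
have k_near : \forall n \near \oo, expR (2 * C) <= k n.
  by move/cvgryPge : k_infty; apply.
have vol_near : \forall n \near \oo, k n / n%:R ^+ 2 <= cvol + 1.
  apply: filterS (near_lt_limn_esup (u := fun n => (k n / n%:R ^+ 2)%:E)
    (l := (cvol + 1)%:E) _) => [n|]; first by rewrite lte_fin => /ltW.
  by apply: le_lt_trans k_vol _; rewrite lte_fin ltrDl.
pose B := `|ln (cvol + 1)| + C.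
(* From this [n] on, the loss of rate [E / n] is harmless up to time [t+], by the
   bound [log n <= 2 sqrt n]. *)
have n_near : \forall n \near \oo, (E * (B + 2)) ^+ 2 <= n%:R :> R.
  exact: nbhs_infty_ger.
have n2_near : \forall n \near \oo, (2 <= n)%N by exists 2%N.
have main : \forall n \near \oo, forall p : R, 1 <= p -> p <= 2 ->
    ((Num.sqrt (k n))%:E * worst_distance (eta_ n) p
       (trel (G n) / 2 * ln (k n) + C * trel (G n)) <= delta%:E)%E /\
    ((delta^-1)%:E <= (Num.sqrt (k n))%:E * worst_distance (eta_ n) p
       (trel (G n) / 2 * ln (k n) - C * trel (G n)))%E.
  near=> n.
  have n2 : (2 <= n)%N by near: n.
  have [dn0 tNn0 Tn0 nash_n] := nashG n n2.
  have cardn := card_G n n2.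
  have card1 : (1 < #|G n|)%N by rewrite cardn.
  have [phi [lam [phi_ortho phi_eigen parseval]]] := eigenbasis (G n).
  have [_ _ [g0 _]] := gap_attained phi_ortho phi_eigen parseval card1.
  have trel0 : 0 < trel (G n) by rewrite invr_gt0.
  have gt1 : gap (G n) * trel (G n) = 1 by rewrite divff // gt_eqF.
  have dD : d n <= D.
    have : `|d n| <= D * `|1 : R| by near: n.
    by rewrite normr1 mulr1 gtr0_norm.
  have tN1 : tN n <= K1 * trel (G n).
    have : `|tN n| <= K1 * `|trel (G n)| by near: n.
    by rewrite !gtr0_norm.
  have T2 : T n <= K2 * tN n.
    have : `|T n| <= K2 * `|tN n| by near: n.
    by rewrite !gtr0_norm.
  have tN3 : tN n <= K * T n.
    have : `|tN n| <= K * `|T n| by near: n.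
    by rewrite !gtr0_norm.
  have Ta : T n <= a * trel (G n).
    apply: le_trans T2 _; rewrite /a [K1 * K2]mulrC -mulrA.
    by rewrite ler_wpM2l // ltW.
  have gapT : gap (G n) * T n <= a.
    have := ler_wpM2l (ltW g0) Ta.
    by rewrite mulrCA gt1 mulr1.
  have kC : expR (2 * C) <= k n by near: n.
  have k0 : 0 < k n := lt_le_trans (expR_gt0 _) kC.
  have lnk : 2 * C <= ln (k n) by rewrite -[leLHS]expRK ler_ln // posrE expR_gt0.
  have sqrtk : Num.sqrt (k n) = expR (ln (k n) / 2).
    rewrite -[in LHS](lnK (k0 : k n \in Num.pos)).
    rewrite (_ : expR (ln (k n)) = expR (ln (k n) / 2) ^+ 2).
      by rewrite sqrtr_sqr gtr0_norm ?expR_gt0.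
    by rewrite expr2 -expRD; congr expR; lra.
  have sk0 : 0 < Num.sqrt (k n) by rewrite sqrtr_gt0.
  have nR : 0 < n%:R :> R by rewrite ltr0n ltnW.
  have vol : k n <= (cvol + 1) * n%:R ^+ 2.
    by rewrite -ler_pdivrMr ?exprn_gt0 //; near: n.
  set tau := ln (k n) / 2 + C.
  have tau0 : 0 <= tau by rewrite /tau; lra.
  have Etau : E / n%:R * tau <= 1.
    rewrite mulrAC ler_pdivrMr // mul1r.
    have cv1 : 0 < cvol + 1 by rewrite ltr_wpDl.
    have s0 : 0 < Num.sqrt n%:R :> R by rewrite sqrtr_gt0.
    have s1 : 1 <= Num.sqrt n%:R :> R.
      by rewrite -[leLHS]sqrtr1 ler_sqrt // ler1n ltnW.
    have h1 : ln (k n) <= ln (cvol + 1) + 4 * Num.sqrt n%:R.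
      apply: le_trans (_ : ln ((cvol + 1) * n%:R ^+ 2) <= _).
        by rewrite ler_ln // posrE mulr_gt0 // exprn_gt0.
      rewrite lnM ?posrE ?exprn_gt0 // lerD2l lnXn //.
      rewrite (_ : ln n%:R *+ 2 = 2 * ln n%:R) ?mulr_natl //.
      have := ln_le_sqrt nR; lra.
    have h2 : tau <= (B + 2) * Num.sqrt n%:R.
      have B0 : 0 <= B by rewrite addr_ge0 // ltW.
      have : B * 1 <= B * Num.sqrt n%:R by rewrite ler_wpM2l.
      have := ler_norm (ln (cvol + 1)).
      have := normr_ge0 (ln (cvol + 1)).
      rewrite /tau /B; lra.
    have h3 : E * (B + 2) <= Num.sqrt n%:R.
      have B0 : 0 <= B by rewrite addr_ge0 // ltW.
      have EB : 0 <= E * (B + 2) by rewrite mulr_ge0 ?addr_ge0 // ltW.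
      rewrite -[leLHS](ger0_norm EB) -sqrtr_sqr ler_sqrt; last exact: ltW.
      by near: n.
    apply: le_trans (_ : E * ((B + 2) * Num.sqrt n%:R) <= _).
      by rewrite ler_wpM2l // ltW.
    rewrite mulrA -[X in _ <= X](sqr_sqrtr (ltW nR)) expr2.
    by rewrite ler_wpM2r // ltW.
  move=> p p1 p2; split.
    have tE : trel (G n) / 2 * ln (k n) + C * trel (G n) = trel (G n) * tau.
      by rewrite /tau; ring.
    rewrite tE.
    have gtau : gap (G n) * (trel (G n) * tau) = tau by rewrite mulrA gt1 mul1r.
    pose s := delta / Num.sqrt (k n).
    have s0 : 0 < s by rewrite divr_gt0.
    have -> : delta%:E = ((Num.sqrt (k n))%:E * s%:E)%E.
      by rewrite -EFinM /s mulrC divfK // gt_eqF.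
    apply: lee_wpmul2l; first by rewrite lee_fin ltW.
    apply: worst_distance_le => //; first by rewrite mulr_ge0 // ltW.
    move=> eta.
    have Tt : T n <= trel (G n) * tau.
      apply: le_trans Ta _; rewrite mulrC ler_pM2l //.
      have : a <= C.
        rewrite /C; have := normr_ge0 (ln (Z / delta ^+ 2)).
        have := normr_ge0 (ln delta); lra.
      rewrite /tau; lra.
    have := decay (G n) (@eta_ n) (d n) (tN n) (T n) (And3 card1 dn0 dD)
      (And4 tNn0 Tn0 tN3 gapT) nash_n (elliptic_sites (ell n n2)) eta _ Tt.
    rewrite gtau cardn => h; apply: le_trans h _.
    have e1 : expR (- 4 * tau) <= expR (- 2 * tau) by rewrite ler_expR; lra.
    have e2 : expR (- 2 * tau + E / n%:R * tau) <= expR (- 2 * tau) * expR 1.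
      by rewrite -expRD ler_expR lerD2l.
    have e3 : expR (- 2 * tau) = expR (- 2 * C) / k n.
      rewrite -[in RHS](lnK (k0 : k n \in Num.pos)) -expRN -expRD; congr expR.
      by rewrite /tau; lra.
    apply: le_trans (_ : expR (- 2 * tau) * Z <= _).
      have := ler_wpM2l (ltW A0) (lerD e1 e2); rewrite /Z; lra.
    rewrite e3 /s expr_div_n sqr_sqrtr ?(ltW k0) // mulrAC ler_pM2r ?invr_gt0 //.
    rewrite -ler_pdivlMr // -[leRHS]lnK ?posrE ?divr_gt0 ?exprn_gt0 // ler_expR.
    have -> : delta ^+ 2 / Z = (Z / delta ^+ 2)^-1 by rewrite invf_div.
    rewrite lnV ?posrE ?divr_gt0 ?exprn_gt0 //.
    have := ler_norm (ln (Z / delta ^+ 2)).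
    have := normr_ge0 (ln (Z / delta ^+ 2)); have := normr_ge0 (ln delta).
    rewrite /C; lra.
  have tE : trel (G n) / 2 * ln (k n) - C * trel (G n) =
      trel (G n) * (ln (k n) / 2 - C) by ring.
  rewrite tE.
  have t0 : 0 <= trel (G n) * (ln (k n) / 2 - C).
    by rewrite mulr_ge0 //; [exact: ltW | lra].
  have := worst_distance_ge (@eta_ n) card1 p1 p2 t0.
  rewrite mulrA mulNr gt1 => h.
  apply: le_trans (lee_wpmul2l _ h); last by rewrite lee_fin ltW.
  rewrite -EFinM lee_fin sqrtk -expRD -[leLHS]lnK ?posrE ?invr_gt0 // ler_expR.
  rewrite lnV ?posrE //.
  have := ler_norm (- ln delta); rewrite normrN.
  have := normr_ge0 (ln (Z / delta ^+ 2)).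
  rewrite /C; lra.
exists C => // p p1 p2; split.
  by apply: limn_esup_le; apply: filterS main => n /(_ p p1 p2)[].
by apply: le_limn_einf; apply: filterS main => n /(_ p p1 p2)[].
Unshelve. all: by end_near.
Qed.
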